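(* There are absolute constants $C_0, C > 0$ such that the following holds. Let $A$ be an $N \times n$ random matrix ($N \ge n$) whose columns $A_1,\dots,A_n$ are independent isotropic random vectors in $\mathbb{R}^N$ with $\|A_j\|_2 = \sqrt{N}$ almost surely for all $j$. Consider the incoherence parameter $$m := \frac{1}{N}\, \mathbb{E} \max_{j \le n} \sum_{k \in \{1,\dots,n\},\, k \ne j} \langle A_j, A_k\rangle^2.$$ Then $$\mathbb{E}\Big\| \frac{1}{N} A^*A - I \Big\| \le C_0 \sqrt{\frac{m \log n}{N}}.$$ In particular, $$\mathbb{E} \max_{j \le n} |s_j(A) - \sqrt{N}| \le C\sqrt{m \log n}.$$
   Context: All matrices are real. For an $N \times n$ matrix $A$, the singular values $s_1(A) \ge \dots \ge s_n(A) \ge 0$ are the eigenvalues of $\sqrt{A^*A}$. $\|\cdot\|$ applied to a matrix is the spectral (operator) norm $\ell_2\to\ell_2$. A random vector $X$ in $\mathbb{R}^N$ is isotropic if $\mathbb{E}\, XX^T = I$, equivalently $\mathbb{E}\langle X,x\rangle^2 = \|x\|_2^2$ for all $x \in \mathbb{R}^N$ (no centering is assumed). *)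

(* Defs.v *)
From HB Require Import structures.
From mathcomp Require Import all_boot all_order all_algebra.
From mathcomp Require Import all_classical all_reals all_analysis.

Set Implicit Arguments.
Unset Strict Implicit.
Unset Printing Implicit Defensive.

Import Order.TTheory GRing.Theory Num.Theory.
Import numFieldNormedType.Exports.

Local Open Scope classical_set_scope.
Local Open Scope ring_scope.

Section euclidean.
Context {R : realType}.

Definition dot {n : nat} (u v : 'cV[R]_n) : R := \sum_(i < n) u i 0 * v i 0.

Definition norm2 {n : nat} (u : 'cV[R]_n) : R := Num.sqrt (dot u u).

(* The set is nonempty (u = 0) and bounded, so its [sup] is the l2 -> l2
   operator norm.  The library's norm on matrices is the entrywise sup norm. *)
Definition opnorm {m n : nat} (M : 'M[R]_(m, n)) : R :=
  sup [set norm2 (M *m u) | u in [set u : 'cV[R]_n | norm2 u <= 1]].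

Definition psdmx {n : nat} (S : 'M[R]_n) : Prop :=
  S^T = S /\ forall u : 'cV[R]_n, 0 <= dot u (S *m u).

(* The default 0 is only taken when M has no positive semidefinite square
   root, i.e. when M itself is not positive semidefinite; the root is unique. *)
Definition sqrtmx {n : nat} (M : 'M[R]_n) : 'M[R]_n :=
  xget 0 [set S | psdmx S /\ S *m S = M].

(* Eigenvalues with multiplicity, in nonincreasing order; the default is only
   taken when the characteristic polynomial does not split over R. *)
Definition eigenvals {n : nat} (M : 'M[R]_n) : n.-tuple R :=
  xget [tuple 0 | _ < n]
    [set s : n.-tuple R | sorted (fun x y => y <= x) s /\
       char_poly M = \prod_(x <- s) ('X - x%:P)].

Definition singular_value {N n : nat} (A : 'M[R]_(N, n)) (j : 'I_n) : R :=
  tnth (eigenvals (sqrtmx (A^T *m A))) j.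

End euclidean.

Section random_vectors.
Context {d : measure_display} {T : measurableType d} {R : realType}.

Definition borel (E : topologicalType) : set (set E) := <<s open >>.

Definition random_vector {N : nat} (X : T -> 'cV[R]_N) : Prop :=
  forall B, borel B -> measurable (X @^-1` B).

Definition isotropic (P : probability T R) {N : nat} (X : T -> 'cV[R]_N)
    : Prop :=
  forall i j : 'I_N,
    ('E_P[fun w => (X w *m (X w)^T)%R i j] = ((1%:M : 'M[R]_N)%R i j)%:E)%E.

Definition independent (P : probability T R) {I : finType} {N : nat}
    (X : I -> T -> 'cV[R]_N) : Prop :=
  forall (J : {set I}) (B : I -> set 'cV[R]_N), (forall i, borel (B i)) ->
    P (\bigcap_(i in [set` J]) X i @^-1` B i) =
      (\prod_(i in J) P (X i @^-1` B i))%E.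

(* The quantities under the max are nonnegative, so the base value 0 of the
   big max is harmless as soon as 0 < n. *)
Definition incoherence (P : probability T R) {N n : nat}
    (A : T -> 'M[R]_(N, n)) : \bar R :=
  ((N%:R^-1)%:E *
   'E_P[fun w => \big[Num.max/0%R]_(j < n)
          (\sum_(k < n | k != j) dot (col j (A w)) (col k (A w)) ^+ 2)%R])%E.

End random_vectors.

(* Main.v *)
Require Import Defs.
From HB Require Import structures.
From mathcomp Require Import all_boot all_order all_algebra.
From mathcomp Require Import all_classical all_reals all_analysis.
From mathcomp Require Import spectral complex ring lra measurable_realfun.

Set Implicit Arguments.
Unset Strict Implicit.
Unset Printing Implicit Defensive.

Import Order.TTheory GRing.Theory Num.Theory.
Import numFieldNormedType.Exports.

Local Open Scope classical_set_scope.
Local Open Scope ring_scope.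

(* Let [G] be the off-diagonal part of the Gram matrix [A^T A].  Decoupling:
   [G] is 4 times the average, over the subsets [S] of the columns, of the
   blocks of [A^T A] with rows in [S] and columns outside [S].  Given the
   columns outside [S], the square of the norm of such a block is the norm of a
   sum of independent rank-one matrices [y_j y_j^T] with [|y_j|^2] at most the
   incoherence; symmetrization by a second copy of the columns and Rudelson's
   inequality bound its expectation by a multiple of
     n (N + E|G|) + ln n * E max_j \sum_(k != j) <A_j, A_k>^2,
   and [n <= N] makes the resulting quadratic inequality for [E|G|] close up.
   Rudelson's inequality follows Tropp's elementary proof: flipping one sign at
   a time bounds the moments [E tr X^(2p)] of a random signed sum [X] by
   induction on [p].

   All expectations above are taken on a finite product space:
   the columns are a.s. on the sphere of radius [sqrt N], so they may be rounded
   to finitely many values by a function of each column separately, which keeps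
   them independent.  Isotropy then holds only up to constant factors, and the
   rounding errors are absorbed because the incoherence sum has expectation at
   least [N / 16]. *)

(** * Euclidean vectors and the operator norm *)

Lemma eq_ler {R : realType} (x y : R) : x = y -> x <= y.
Proof. by move=> ->. Qed.

Section dot_product.
Context {R : realType}.
Implicit Types m n : nat.

Lemma dotE n (u v : 'cV[R]_n) : dot u v = (u^T *m v) 0 0.
Proof. by rewrite mxE; apply: eq_bigr => i _; rewrite mxE. Qed.

Lemma dotC n (u v : 'cV[R]_n) : dot u v = dot v u.
Proof. by apply: eq_bigr => i _; rewrite mulrC. Qed.

Lemma dotDr n (u v w : 'cV[R]_n) : dot u (v + w) = dot u v + dot u w.
Proof. by rewrite !dotE mulmxDr mxE. Qed.

Lemma dotZr n a (u v : 'cV[R]_n) : dot u (a *: v) = a * dot u v.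
Proof. by rewrite !dotE -scalemxAr mxE. Qed.

Lemma dotBr n (u v w : 'cV[R]_n) : dot u (v - w) = dot u v - dot u w.
Proof. by rewrite !dotE mulmxBr !mxE. Qed.

Lemma dotDl n (u v w : 'cV[R]_n) : dot (v + w) u = dot v u + dot w u.
Proof. by rewrite dotC dotDr !(dotC u). Qed.

Lemma dotZl n a (u v : 'cV[R]_n) : dot (a *: u) v = a * dot u v.
Proof. by rewrite dotC dotZr dotC. Qed.

Lemma dot0r n (u : 'cV[R]_n) : dot u 0 = 0.
Proof. by rewrite dotE mulmx0 mxE. Qed.

Lemma dot_sumr n I (r : seq I) (P : pred I) (u : 'cV[R]_n) (F : I -> 'cV[R]_n) :
  dot u (\sum_(i <- r | P i) F i) = \sum_(i <- r | P i) dot u (F i).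
Proof.
apply: (big_morph (dot u)); [exact: dotDr | exact: dot0r].
Qed.

Lemma dot_mulmxr m n (u : 'cV[R]_m) (M : 'M[R]_(m, n)) (v : 'cV[R]_n) :
  dot u (M *m v) = dot (M^T *m u) v.
Proof. by rewrite !dotE trmx_mul trmxK mulmxA. Qed.

Lemma dot_ge0 n (u : 'cV[R]_n) : 0 <= dot u u.
Proof. by apply: sumr_ge0 => i _; rewrite -expr2 sqr_ge0. Qed.

Lemma dot_eq0 n (u : 'cV[R]_n) : (dot u u == 0) = (u == 0).
Proof.
apply/eqP/eqP => [h|->]; last by rewrite dot0r.
apply/matrixP => i j; rewrite ord1 mxE; apply/eqP.
have /(_ (fun i _ => sqr_ge0 (u i 0))) := @psumr_eq0P R _ xpredT (fun i => u i 0 ^+ 2).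
have -> : \sum_i u i 0 ^+ 2 = dot u u by apply: eq_bigr => k _; rewrite expr2.
by rewrite h =>  /(_ erefl i isT)/eqP; rewrite sqrf_eq0.
Qed.

Lemma CauchySchwarz_dot n (u v : 'cV[R]_n) : dot u v ^+ 2 <= dot u u * dot v v.
Proof.
have [/eqP|u0] := eqVneq (dot u u) 0.
  by rewrite dot_eq0 => /eqP ->; rewrite dotC !dot0r expr0n mul0r.
have pu : 0 < dot u u by rewrite lt_def u0 dot_ge0.
have := dot_ge0 (v - (dot u v / dot u u) *: u).
rewrite -scaleNr !dotDr !dotDl !dotZl !dotZr (dotC v u).
set a := dot u u; set b := dot u v; set c := dot v v => h.
rewrite -(ler_pM2l pu) -/a.
have : 0 <= a * a * (c + - (b / a) * b + (- (b / a) * b + - (b / a) * (- (b / a) * a))).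
  by rewrite mulr_ge0 // ltW // mulr_gt0.
have -> : a * a * (c + - (b / a) * b + (- (b / a) * b + - (b / a) * (- (b / a) * a)))
  = a * (a * c) - a * b ^+ 2 by field.
by rewrite subr_ge0.
Qed.

Lemma norm2_ge0 n (u : 'cV[R]_n) : 0 <= norm2 u.
Proof. exact: sqrtr_ge0. Qed.

Lemma sqr_norm2 n (u : 'cV[R]_n) : norm2 u ^+ 2 = dot u u.
Proof. by rewrite sqr_sqrtr // dot_ge0. Qed.

Lemma norm2_eq0 n (u : 'cV[R]_n) : (norm2 u == 0) = (u == 0).
Proof. by rewrite -dot_eq0 -sqr_norm2 sqrf_eq0. Qed.

Lemma norm2Z n a (u : 'cV[R]_n) : norm2 (a *: u) = `|a| * norm2 u.
Proof. by rewrite /norm2 dotZl dotZr mulrA -expr2 sqrtrM ?sqr_ge0// sqrtr_sqr. Qed.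

Lemma norm20 n : norm2 (0 : 'cV[R]_n) = 0.
Proof. by rewrite /norm2 dot0r sqrtr0. Qed.

Lemma le_norm2 m n (u : 'cV[R]_m) (v : 'cV[R]_n) c : 0 <= c ->
  (norm2 u <= c * norm2 v) = (dot u u <= c ^+ 2 * dot v v).
Proof.
move=> c0; rewrite -!sqr_norm2 -exprMn ler_sqr ?nnegrE ?mulr_ge0 ?norm2_ge0//.
Qed.

Lemma ler_dot_norm2 n (u v : 'cV[R]_n) : `|dot u v| <= norm2 u * norm2 v.
Proof.
rewrite -ler_sqr ?nnegrE ?mulr_ge0 ?norm2_ge0// exprMn !sqr_norm2 (real_normK (num_real _)).
exact: CauchySchwarz_dot.
Qed.

Lemma ler_norm2D n (u v : 'cV[R]_n) : norm2 (u + v) <= norm2 u + norm2 v.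
Proof.
rewrite -ler_sqr ?nnegrE ?addr_ge0 ?norm2_ge0// sqrrD !sqr_norm2.
rewrite dotDr !dotDl (dotC v u).
have := le_trans (ler_norm _) (ler_dot_norm2 u v); lra.
Qed.

Lemma norm2_coord n (u : 'cV[R]_n) i : `|u i 0| <= norm2 u.
Proof.
rewrite -ler_sqr ?nnegrE ?norm2_ge0// (real_normK (num_real _)) sqr_norm2.
rewrite /dot (bigD1 i)//= -expr2 lerDl.
by apply: sumr_ge0 => k _; rewrite -expr2 sqr_ge0.
Qed.

End dot_product.

Section operator_norm.
Context {R : realType}.
Implicit Types m n : nat.

(** Crude, but it shows that the supremum in [opnorm] is over a bounded set, and it turns entrywise
    bounds into bounds on [opnorm]. *)
Lemma ler_norm2_mulmx m n (M : 'M[R]_(m, n)) (u : 'cV[R]_n) :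
  norm2 (M *m u) <= (\sum_i \sum_j `|M i j|) * norm2 u.
Proof.
have S0 : 0 <= \sum_i \sum_j `|M i j|.
  by apply: sumr_ge0 => i _; apply: sumr_ge0.
have l1 (x : 'cV[R]_m) : norm2 x <= \sum_i `|x i 0|.
  have s0 : 0 <= \sum_i `|x i 0| by apply: sumr_ge0.
  rewrite -ler_sqr ?nnegrE ?norm2_ge0// sqr_norm2 expr2 big_distrl /=.
  apply: ler_sum => i _; rewrite -expr2 -(real_normK (num_real _)) expr2 ler_wpM2l//.
  by rewrite (bigD1 i)//= lerDl; apply: sumr_ge0.
apply: le_trans (l1 _) _; rewrite big_distrl /=; apply: ler_sum => i _.
rewrite mxE; apply: le_trans (ler_norm_sum _ _ _) _.
rewrite big_distrl /=; apply: ler_sum => j _.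
by rewrite normrM ler_wpM2l// norm2_coord.
Qed.

Lemma opnorm_has_sup m n (M : 'M[R]_(m, n)) :
  has_sup [set norm2 (M *m u) | u in [set u : 'cV[R]_n | norm2 u <= 1]].
Proof.
split; first by exists (norm2 (M *m 0)), 0 => //=; rewrite norm20.
exists (\sum_i \sum_j `|M i j|) => _ [u /= u1 <-].
apply: le_trans (ler_norm2_mulmx _ _) _.
by rewrite ler_piMr//; apply: sumr_ge0 => i _; apply: sumr_ge0.
Qed.

Lemma opnorm_le m n (M : 'M[R]_(m, n)) c : 0 <= c ->
  (forall u, norm2 (M *m u) <= c * norm2 u) -> opnorm M <= c.
Proof.
move=> c0 h; apply: ge_sup; first by have [] := opnorm_has_sup M.
by move=> _ [u /= u1 <-]; apply: le_trans (h u) _; rewrite ler_piMr.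
Qed.

Lemma opnorm_ge0 m n (M : 'M[R]_(m, n)) : 0 <= opnorm M.
Proof.
apply: le_trans (norm2_ge0 (M *m 0)) _.
by apply: ub_le_sup; [have [] := opnorm_has_sup M | exists 0 => //=; rewrite norm20].
Qed.

Lemma ler_norm2_opnorm m n (M : 'M[R]_(m, n)) u :
  norm2 (M *m u) <= opnorm M * norm2 u.
Proof.
have [->|u0] := eqVneq u 0; first by rewrite mulmx0 !norm20 mulr0.
have pu : 0 < norm2 u by rewrite lt_def norm2_eq0 u0 norm2_ge0.
rewrite -ler_pdivrMr// mulrC.
rewrite -[(norm2 u)^-1]ger0_norm ?invr_ge0 ?norm2_ge0// -norm2Z scalemxAr.
apply: ub_le_sup; first by have [] := opnorm_has_sup M.
exists ((norm2 u)^-1 *: u) => //=.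
by rewrite norm2Z ger0_norm ?invr_ge0 ?norm2_ge0// mulVf ?gt_eqF.
Qed.

Lemma ler_quad_opnorm n (M : 'M[R]_n) u : dot u (M *m u) <= opnorm M * dot u u.
Proof.
apply: le_trans (ler_norm _) _; apply: le_trans (ler_dot_norm2 _ _) _.
by rewrite -sqr_norm2 expr2 mulrCA ler_wpM2l ?norm2_ge0// ler_norm2_opnorm.
Qed.

Lemma opnorm0 m n : opnorm (0 : 'M[R]_(m, n)) = 0.
Proof.
by apply/le_anti; rewrite opnorm_ge0 andbT opnorm_le// => u; rewrite mul0mx norm20 mul0r.
Qed.

Lemma opnormZ_le m n a (M : 'M[R]_(m, n)) : opnorm (a *: M) <= `|a| * opnorm M.
Proof.
apply: opnorm_le => [|u]; first by rewrite mulr_ge0 ?opnorm_ge0.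
by rewrite -scalemxAl norm2Z -mulrA ler_wpM2l// ler_norm2_opnorm.
Qed.

Lemma opnormN m n (M : 'M[R]_(m, n)) : opnorm (- M) = opnorm M.
Proof.
apply/le_anti/andP; split.
  by rewrite -scaleN1r (le_trans (opnormZ_le _ _))// normrN1 mul1r.
by rewrite -{1}[M]opprK -scaleN1r (le_trans (opnormZ_le _ _))// normrN1 mul1r.
Qed.

Lemma opnormD m n (M L : 'M[R]_(m, n)) : opnorm (M + L) <= opnorm M + opnorm L.
Proof.
apply: opnorm_le => [|u]; first by rewrite addr_ge0 ?opnorm_ge0.
rewrite mulmxDl mulrDl; apply: le_trans (ler_norm2D _ _) _.
by rewrite lerD ?ler_norm2_opnorm.
Qed.

Lemma opnorm_sum m n I (r : seq I) (P : pred I) (F : I -> 'M[R]_(m, n)) :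
  opnorm (\sum_(i <- r | P i) F i) <= \sum_(i <- r | P i) opnorm (F i).
Proof.
elim/big_rec2: _ => [|i x M _ h]; first by rewrite opnorm0.
by apply: le_trans (opnormD _ _) _; rewrite lerD2l.
Qed.

Lemma opnorm_le_entries m n (M : 'M[R]_(m, n)) c :
  (forall i j, `|M i j| <= c) -> opnorm M <= (m * n)%:R * c.
Proof.
move=> h; apply: (@le_trans _ _ (\sum_i \sum_j `|M i j|)).
  apply: opnorm_le => [|u]; last exact: ler_norm2_mulmx.
  by apply: sumr_ge0 => i _; apply: sumr_ge0.
apply: (@le_trans _ _ (\sum_(i < m) \sum_(j < n) c)).
  by apply: ler_sum => i _; apply: ler_sum => j _.
by rewrite !sumr_const !card_ord -mulrnA mulnC mulr_natl.
Qed.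

End operator_norm.

(** * Symmetric matrices and singular values *)

Section spectral_theorem.
Context {R : realType}.
Implicit Types n : nat.

(** A complex eigenvector [a + i b] for [x + i y] splits into [S a = x a - y b] and
    [S b = x b + y a]. Symmetry of [S] forces [y = 0], so whichever of [a], [b] is nonzero is a real
    eigenvector. *)
Lemma symmetric_eigenvector n (S : 'M[R]_n.+1) : S^T = S ->
  exists x (u : 'cV[R]_n.+1), u != 0 /\ S *m u = x *: u.
Proof.
move=> sS.
have [[x y] /eigenvalueP[v vS v0]] :=
  @eigenvalue_closed (R[i])%C n.+1 (map_mx (real_complex R) S) isT.
pose a : 'cV[R]_n.+1 := \col_i complex.Re (v 0 i).
pose b : 'cV[R]_n.+1 := \col_i complex.Im (v 0 i).
have E i : (\sum_j S i j * a j 0 = x * a i 0 - y * b i 0) /\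
           (\sum_j S i j * b j 0 = x * b i 0 + y * a i 0).
  have /rowP/(_ i) := vS; rewrite !mxE => /eqP.
  rewrite eq_complex => /andP[/eqP re /eqP im].
  have ReS (F : 'I_n.+1 -> R[i]%C) : complex.Re (\sum_j F j) = \sum_j complex.Re (F j).
    by apply: (big_morph _ _ erefl) => -[? ?] [? ?].
  have ImS (F : 'I_n.+1 -> R[i]%C) : complex.Im (\sum_j F j) = \sum_j complex.Im (F j).
    by apply: (big_morph _ _ erefl) => -[? ?] [? ?].
  rewrite ReS in re; rewrite ImS in im; split.
    transitivity (complex.Re ((x +i* y)%C * v 0 i)); last by case: (v 0 i).
    rewrite -re; apply: eq_bigr => j _; rewrite !mxE -[S in LHS]sS mxE.
    by case: (v 0 j) => c d /=; rewrite mulr0 subr0 mulrC.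
  transitivity (complex.Im ((x +i* y)%C * v 0 i)); last by case: (v 0 i).
  rewrite -im; apply: eq_bigr => j _; rewrite !mxE -[S in LHS]sS mxE.
  by case: (v 0 j) => c d /=; rewrite mulr0 add0r mulrC.
have Sa : S *m a = x *: a - y *: b.
  by apply/colP => i; rewrite mxE (E i).1 !mxE.
have Sb : S *m b = x *: b + y *: a.
  by apply/colP => i; rewrite mxE (E i).2 !mxE.
have ab0 : dot a a + dot b b != 0.
  apply: contra_neq v0 => h; have [a0 b0] : dot a a = 0 /\ dot b b = 0.
    by have := dot_ge0 a; have := dot_ge0 b; lra.
  move/eqP: a0; move/eqP: b0; rewrite !dot_eq0 => /eqP b0 /eqP a0.
  apply/rowP => i; have /colP/(_ i) := a0; have /colP/(_ i) := b0; rewrite !mxE.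
  by case: (v 0 i) => c d /= -> ->.
have y0 : y = 0.
  have : dot b (S *m a) = dot a (S *m b) by rewrite dot_mulmxr sS dotC.
  rewrite Sa Sb -scaleNr !dotDr !dotZr (dotC b a) => h.
  have /eqP : y * (dot a a + dot b b) = 0 by lra.
  by rewrite mulf_eq0 (negbTE ab0) orbF => /eqP.
have [a0|a0] := eqVneq a 0; last by exists x, a; rewrite Sa y0 scale0r subr0.
exists x, b; rewrite Sb y0 scale0r addr0; split => //.
by apply: contra_neq ab0 => ->; rewrite a0 !dot0r addr0.
Qed.

(** The reflection in the hyperplane orthogonal to [e - u] exchanges the unit vectors [e] and [u].
    It stands in for completing [u] to an orthonormal basis. *)
Lemma householder n (u : 'cV[R]_n.+1) : dot u u = 1 ->
  exists H : 'M[R]_n.+1, [/\ H^T = H, H *m H = 1%:M & H *m delta_mx 0 0 = u].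
Proof.
move=> u1; pose e : 'cV[R]_n.+1 := delta_mx 0 0.
have e1 : dot e e = 1.
  rewrite /dot (bigD1 0)//= big1 ?mxE ?eqxx/= ?mulr1 ?addr0// => i i0.
  by rewrite !mxE (negbTE i0) mul0r.
have [eu|eu] := eqVneq (e - u) 0.
  exists 1%:M; split; rewrite ?trmx1 ?mulmx1 ?mul1mx//.
  by apply/eqP; rewrite -subr_eq0 eu.
pose w := e - u; pose k := 2 / dot w w.
have w0 : dot w w != 0 by rewrite dot_eq0.
exists (1%:M - k *: (w *m w^T)); split.
- by rewrite linearB/= linearZ/= trmx_mul trmxK trmx1.
- rewrite mulmxBl mul1mx mulmxBr mulmx1 -scalemxAl -scalemxAr.
  rewrite mulmxA -(mulmxA w) [w^T *m w]mx11_scalar -dotE.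
  rewrite mul_mx_scalar -!scalemxAl !scalerA.
  rewrite -addrA -opprD -!scalerBl -scalerDl (_ : k + _ = 0) ?scale0r ?subr0//.
  by rewrite /k; move: (dot w w) w0 => t t0; field.
- rewrite mulmxBl mul1mx -scalemxAl -mulmxA [w^T *m _]mx11_scalar -dotE.
  rewrite mul_mx_scalar scalerA -/e.
  have -> : k * dot w e = 1.
    move: w0; rewrite /k /w -scaleN1r !dotDl !dotDr !dotZl !dotZr u1 e1 (dotC u e).
    move: (dot e u) => t.
    have -> : 1 + -1 * t + (-1 * t + -1 * (-1 * 1)) = 2 - 2 * t by ring.
    by move=> h; field.
  by rewrite scale1r /w opprB addrC subrK.
Qed.

(** Induction on the dimension: a reflection moves an eigenvector to the first basis vector. By
    symmetry the conjugated matrix is then block diagonal, and the induction hypothesis applies to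
    its lower right block. *)
Theorem real_spectral n (S : 'M[R]_n) : S^T = S ->
  exists (Q : 'M[R]_n) (l : 'rV[R]_n), Q^T *m Q = 1%:M /\ S = Q *m diag_mx l *m Q^T.
Proof.
elim: n S => [|n IH] S sS.
  by exists 1%:M, 0; split; apply/matrixP => -[].
have [x [u0 [u00 Su0]]] := symmetric_eigenvector sS.
pose u := (norm2 u0)^-1 *: u0.
have nu0 : norm2 u0 != 0 by rewrite norm2_eq0.
have u1 : dot u u = 1.
  by rewrite -sqr_norm2 norm2Z ger0_norm ?invr_ge0 ?norm2_ge0// mulVf// expr1n.
have Su : S *m u = x *: u by rewrite -scalemxAr Su0 !scalerA mulrC.
have [H [sH HH He]] := householder u1.
pose S' : 'M[R]_n.+1 := H *m S *m H.
have sS' : S'^T = S' by rewrite /S' !trmx_mul sH sS mulmxA.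
pose e : 'cV[R]_n.+1 := delta_mx 0 0.
have S'e : S' *m e = x *: e.
  by rewrite /S' -!mulmxA [H *m e]He Su -He -scalemxAr mulmxA HH mul1mx.
have SE : S = H *m S' *m H by rewrite /S' !mulmxA HH mul1mx -mulmxA HH mulmx1.
clearbody S'.
have colS' i : S' i 0 = x * (i == 0)%:R.
  have /colP/(_ i) := S'e; rewrite !mxE (bigD1 0)//= big1 ?addr0 => [|j j0].
    by rewrite mxE !eqxx mulr1 andbT.
  by rewrite mxE (negbTE j0) mulr0.
have L0 : @lshift 1 n 0 = 0 :> 'I_n.+1 by exact: val_inj.
have R0 (j : 'I_n) : (@rshift 1 n j == 0 :> 'I_n.+1) = false by [].
have S'E : (S' : 'M[R]_(1 + n)) =
    block_mx (x%:M : 'M[R]_1) 0 0 (drsubmx (S' : 'M[R]_(1 + n))).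
  rewrite -[LHS](@submxK _ 1 n 1 n); congr block_mx.
  - rewrite [LHS]mx11_scalar !mxE; congr _%:M.
    by rewrite -[RHS]mulr1 -(colS' 0) L0.
  - apply/matrixP => i j; rewrite !mxE ord1 L0 -sS' mxE.
    by have := colS' (rshift 1 j); rewrite R0 mulr0.
  - apply/matrixP => i j; rewrite !mxE ord1 L0.
    by have := colS' (rshift 1 i); rewrite R0 mulr0.
have [|Q [l [QQ drE]]] := IH (drsubmx (S' : 'M[R]_(1 + n))).
  by rewrite trmx_drsub sS'.
pose Q' : 'M[R]_(1 + n) := block_mx 1%:M 0 0 Q.
have Q'T : Q'^T = block_mx 1%:M 0 0 Q^T by rewrite tr_block_mx !trmx0 trmx1.
have QQ' : Q'^T *m Q' = 1%:M.
  rewrite Q'T mulmx_block !(mul0mx, mulmx0, mul1mx, addr0, add0r) QQ.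
  by rewrite -scalar_mx_block.
pose l' : 'rV[R]_(1 + n) := row_mx (x%:M : 'M[R]_1) l.
have QlQ : Q' *m diag_mx l' *m Q'^T = (S' : 'M[R]_(1 + n)).
  have dx : diag_mx (x%:M : 'M[R]_1) = x%:M.
    by apply/matrixP => i j; rewrite !ord1 !mxE !eqxx.
  rewrite S'E Q'T drE /l' diag_mx_row dx !mulmx_block.
  by rewrite !(mul0mx, mulmx0, mul1mx, mulmx1, addr0, add0r).
exists (H *m (Q' : 'M[R]_n.+1)), l'; split.
  rewrite trmx_mul sH mulmxA -(mulmxA _ H H) HH mulmx1; exact: QQ'.
by rewrite SE -QlQ trmx_mul sH !mulmxA.
Qed.

End spectral_theorem.

(** * Consequences of the spectral theorem: norms, traces, square roots, eigenvalues *)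

Section symmetric_matrices.
Context {R : realType}.
Implicit Types n : nat.

Lemma orthogonal_dot n (Q : 'M[R]_n) (x : 'cV[R]_n) : Q^T *m Q = 1%:M ->
  dot x x = \sum_i ((Q^T *m x) i 0) ^+ 2.
Proof.
move=> /mulmx1C QQ; rewrite -{2}[x]mul1mx -QQ -mulmxA dot_mulmxr.
by apply: eq_bigr => i _; rewrite expr2.
Qed.

Lemma spectral_exp n (Q : 'M[R]_n) (l : 'rV[R]_n) k : Q^T *m Q = 1%:M ->
  (Q *m diag_mx l *m Q^T) ^+ k = Q *m diag_mx (\row_i (l 0 i ^+ k)) *m Q^T.
Proof.
move=> QQ; elim: k => [|k IH].
  rewrite expr0 (_ : \row_i _ = const_mx 1) ?diag_const_mx ?mulmx1 ?(mulmx1C QQ)//.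
  by apply/rowP => i; rewrite !mxE expr0.
rewrite exprS IH -mulmxE !mulmxA -(mulmxA (Q *m diag_mx l)) QQ mulmx1.
congr (_ *m _); rewrite -mulmxA; congr (_ *m _).
apply/matrixP => i j; rewrite mul_diag_mx !mxE exprS.
by case: eqP => [->|_]; rewrite ?mulr1n // !mulr0n mulr0.
Qed.

Lemma spectral_quad n (Q : 'M[R]_n) (l : 'rV[R]_n) (x : 'cV[R]_n) :
  dot x (Q *m diag_mx l *m Q^T *m x) = \sum_i l 0 i * ((Q^T *m x) i 0) ^+ 2.
Proof.
rewrite -!mulmxA dot_mulmxr /dot; apply: eq_bigr => i _.
by rewrite mul_diag_mx [(\matrix_(_, _) _) i 0]mxE mulrCA expr2.
Qed.

Lemma spectral_trace n (Q : 'M[R]_n) (l : 'rV[R]_n) : Q^T *m Q = 1%:M ->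
  \tr (Q *m diag_mx l *m Q^T) = \sum_i l 0 i.
Proof.
by move=> QQ; rewrite mxtrace_mulC mulmxA QQ mul1mx mxtrace_diag.
Qed.

Lemma spectral_eigenvalue n (Q : 'M[R]_n) (l : 'rV[R]_n) i : Q^T *m Q = 1%:M ->
  Q *m diag_mx l *m Q^T *m col i Q = l 0 i *: col i Q /\
  dot (col i Q) (col i Q) = 1.
Proof.
move=> QQ; have Qc : Q^T *m col i Q = delta_mx i 0.
  by rewrite colE mulmxA QQ mul1mx.
split.
  rewrite -mulmxA Qc -mulmxA mul_diag_mx colE scalemxAr; congr (_ *m _).
  apply/matrixP => j k; rewrite !mxE; case: eqP => [->//|_].
  by rewrite /= !mulr0.
have /matrixP/(_ i i) := QQ; rewrite !mxE eqxx mulr1n => <-.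
by apply: eq_bigr => j _; rewrite !mxE.
Qed.

(** The form at a unit eigenvector is the eigenvalue, so all eigenvalues are at most [c] in absolute
    value; [|S u|^2] is the form of [S ^+ 2] at [u]. *)
Lemma opnorm_le_quad n (S : 'M[R]_n) c : S^T = S -> 0 <= c ->
  (forall x : 'cV[R]_n, `|dot x (S *m x)| <= c * dot x x) -> opnorm S <= c.
Proof.
move=> sS c0 h; have [Q [l [QQ SE]]] := real_spectral sS.
apply: opnorm_le => // u; rewrite le_norm2//.
rewrite dot_mulmxr sS mulmxA dotC mulmxE -expr2 SE spectral_exp// spectral_quad.
rewrite (orthogonal_dot u QQ) mulr_sumr; apply: ler_sum => i _.
rewrite mxE ler_wpM2r ?sqr_ge0//.
have [e1 e2] := spectral_eigenvalue l i QQ.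
have := h (col i Q); rewrite SE e1 dotZr e2 !mulr1 => hi.
by rewrite -(real_normK (num_real (l 0 i))) ler_sqr ?nnegrE.
Qed.

(** The norm is at most the largest absolute eigenvalue, whose even power is one of the nonnegative
    terms of the trace. *)
Lemma opnorm_exp_le_trace n (S : 'M[R]_n) p : S^T = S -> (0 < p)%N ->
  opnorm S ^+ (p.*2) <= \tr (S ^+ (p.*2)).
Proof.
move=> sS p0; have [Q [l [QQ SE]]] := real_spectral sS.
have e0 (a : R) : 0 <= a ^+ p.*2 by rewrite -mul2n exprM exprn_ge0 ?sqr_ge0.
case: n => [|n] in S sS Q l QQ SE *.
  rewrite (_ : S = 0); last by apply/matrixP => -[].
  rewrite opnorm0 expr0n double_eq0 -leqn0 leqNgt p0 mulr0n /mxtrace.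
  by rewrite big_ord0.
rewrite {2}SE spectral_exp// spectral_trace//.
have [i _ hi] :=
  @Order.TotalTheory.arg_maxP _ R 'I_n.+1 ord0 xpredT (fun i => `|l 0 i|) isT.
apply: (@le_trans _ _ (`|l 0 i| ^+ p.*2)).
  rewrite lerXn2r ?nnegrE ?opnorm_ge0// ?ler_norm//.
  apply: opnorm_le_quad => // x.
  rewrite SE spectral_quad (orthogonal_dot x QQ) mulr_sumr.
  apply: le_trans (ler_norm_sum _ _ _) _; apply: ler_sum => j _.
  by rewrite normrM [`|_ ^+ 2|]ger0_norm ?sqr_ge0// ler_wpM2r ?sqr_ge0//; exact: hi.
rewrite -mul2n exprM (real_normK (num_real _)) -exprM mul2n.
rewrite (bigD1 i)//= mxE lerDl; apply: sumr_ge0 => j _; by rewrite mxE e0.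
Qed.

(** Guarantees that [sqrtmx] returns a genuine square root on Gram matrices. *)
Lemma psdmx_sqrt n (M : 'M[R]_n) : psdmx M ->
  exists S : 'M[R]_n, psdmx S /\ S *m S = M.
Proof.
move=> [sM pM]; have [Q [l [QQ ME]]] := real_spectral sM.
have l0 i : 0 <= l 0 i.
  have [e1 e2] := spectral_eigenvalue l i QQ.
  by have := pM (col i Q); rewrite ME e1 dotZr e2 mulr1.
exists (Q *m diag_mx (\row_i Num.sqrt (l 0 i)) *m Q^T); split; first split.
- by rewrite !trmx_mul trmxK tr_diag_mx mulmxA.
- move=> u; rewrite spectral_quad; apply: sumr_ge0 => i _.
  by rewrite mxE mulr_ge0 ?sqrtr_ge0 ?sqr_ge0.
- rewrite mulmxE -expr2 spectral_exp// ME; congr (_ *m diag_mx _ *m _).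
  by apply/rowP => i; rewrite !mxE sqr_sqrtr.
Qed.

Lemma char_poly_orthogonal n (Q D : 'M[R]_n) : Q^T *m Q = 1%:M ->
  char_poly (Q *m D *m Q^T) = char_poly D.
Proof.
move=> QQ; rewrite /char_poly /char_poly_mx !map_mxM.
have PP : map_mx polyC Q *m map_mx polyC Q^T = 1%:M.
  by rewrite -map_mxM (mulmx1C QQ) map_mx1.
rewrite [in LHS](_ : 'X%:M = map_mx polyC Q *m 'X%:M *m map_mx polyC Q^T); last first.
  by rewrite mul_mx_scalar -scalemxAl PP scale_scalar_mx mulr1.
by rewrite -mulmxBl -mulmxBr !det_mulmx mulrAC -det_mulmx PP det1 mul1r.
Qed.

Lemma eigenvals_symmetric n (S : 'M[R]_n) i : S^T = S ->
  exists2 v : 'cV[R]_n, v != 0 & S *m v = tnth (eigenvals S) i *: v.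
Proof.
move=> sS; have [Q [l [QQ SE]]] := real_spectral sS.
(* A suitable tuple exists, namely the sorted diagonal from the spectral theorem, so [eigenvals S]
   is not the default value. *)
have : exists s : n.-tuple R, sorted (fun x y => y <= x) s /\
       char_poly S = \prod_(x <- s) ('X - x%:P).
  pose s := sort (fun x y => y <= x) (codom (l 0)).
  have ss : size s == n by rewrite size_sort size_codom card_ord.
  exists (Tuple ss); split; first by apply: sort_sorted => x y; exact: le_total.
  rewrite /= (perm_big (codom (l 0))) ?perm_sort//=.
  rewrite big_map big_enum /=.
  rewrite SE char_poly_orthogonal// char_poly_trig ?diag_mx_is_trig//.
  by apply: eq_bigr => j _; rewrite mxE eqxx mulr1n.
case=> s hs; have [_] : sorted (fun x y => y <= x) (eigenvals S) /\
    char_poly S = \prod_(x <- eigenvals S) ('X - x%:P).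
  by rewrite /eigenvals; case: xgetP => [t _ //|/(_ s)].
move: (eigenvals S) => t hc.
have : root (char_poly S) (tnth t i).
  by rewrite hc root_prod_XsubC; exact: mem_tnth.
rewrite -eigenvalue_root_char => /eigenvalueP[v vS v0].
exists v^T; first by rewrite -(trmx0 R) (inj_eq (can_inj (@trmxK _ _ _))).
by rewrite -{1}sS -trmx_mul vS linearZ.
Qed.

Lemma trmx_gram N n (A : 'M[R]_(N, n)) : (A^T *m A)^T = A^T *m A.
Proof. by rewrite trmx_mul trmxK. Qed.

(* An eigenvector [v] of [sqrtmx (A^T *m A)] for [s] is one of [A^T *m A] for
   [s ^+ 2], and [|s - r| * (s + r) = |s ^+ 2 - r ^+ 2|] with [r <= s + r]. *)
Lemma singular_value_deviation N n (A : 'M[R]_(N, n)) j : (0 < N)%N ->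
  `|singular_value A j - Num.sqrt N%:R| <=
  Num.sqrt N%:R * opnorm (N%:R^-1 *: (A^T *m A) - 1%:M).
Proof.
move=> N0; rewrite /singular_value; set S := sqrtmx _.
have [[sS pS] SS] : psdmx S /\ S *m S = A^T *m A.
  have [|S0 hS0] := @psdmx_sqrt n (A^T *m A).
    by split; [exact: trmx_gram | move=> u; rewrite -mulmxA dot_mulmxr trmxK dot_ge0].
  by rewrite /S /sqrtmx; case: xgetP => [B -> []|/(_ S0)].
have [v v0 Sv] := eigenvals_symmetric j sS.
move: Sv; set s := tnth _ _ => Sv.
have pv : 0 < dot v v by rewrite lt_def dot_eq0 v0 dot_ge0.
have s0 : 0 <= s by have := pS v; rewrite Sv dotZr pmulr_lge0.
set r := Num.sqrt N%:R.
have r0 : 0 < r by rewrite sqrtr_gt0 ltr0n.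
have rN : r ^+ 2 = N%:R by rewrite sqr_sqrtr ?ler0n.
have := ler_norm2_opnorm (N%:R^-1 *: (A^T *m A) - 1%:M) v.
rewrite mulmxBl mul1mx -scalemxAl -SS -mulmxA Sv -scalemxAr Sv !scalerA -rN.
rewrite -{2}[v]scale1r -scalerBl norm2Z ler_pM2r ?sqrtr_gt0// => h.
have -> : s - r = r * ((s / r) - 1) by field; exact: lt0r_neq0.
rewrite normrM (gtr0_norm r0) ler_pM2l//; apply: le_trans h.
have -> : (r ^+ 2)^-1 * s * s - 1 = (s / r - 1) * (s / r + 1).
  by field; exact: lt0r_neq0.
have sr0 : 0 <= s / r by rewrite divr_ge0// ltW.
by rewrite normrM ler_peMr// ger0_norm ?addr_ge0// lerDr.
Qed.

End symmetric_matrices.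

(** * Rudelson's inequality *)

Section rudelson.
Context {R : realType}.

(** Telescoping sum. For two signed sums that differ in one sign, [x - y] has rank one and each term
    becomes a product of two quadratic forms. *)
Lemma subrXX_noncomm (A : pzRingType) (x y : A) k :
  x ^+ k.+1 - y ^+ k.+1 = \sum_(q < k.+1) x ^+ q * (x - y) * y ^+ (k - q).
Proof.
elim: k => [|k IH]; first by rewrite big_ord1 !expr1 !expr0 mul1r mulr1.
rewrite big_ord_recl expr0 mul1r subn0.
under eq_bigr do rewrite /= /bump add1n exprS -!(mulrA x) subSS.
rewrite -mulr_sumr -IH mulrBr mulrBl -!exprS [RHS]addrC addrA.
by congr (_ - _); rewrite subrK.
Qed.

(** The total exponent is even, so [a] and [b] may be replaced by their absolute values; then
    [|a|^q - |b|^q] and [|a|^s - |b|^s] have the same sign. *)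
Lemma power_exchange (a b : R) r q : (q <= r.*2)%N ->
  a ^+ q * b ^+ (r.*2 - q) + a ^+ (r.*2 - q) * b ^+ q <= a ^+ r.*2 + b ^+ r.*2.
Proof.
move=> qr; set s := (r.*2 - q)%N.
have nn (x : R) : x ^+ r.*2 = `|x| ^+ q * `|x| ^+ s.
  rewrite -exprD subnKC// -normrX ger0_norm// -mul2n exprM exprn_ge0 ?sqr_ge0//.
rewrite !nn; apply: (@le_trans _ _ (`|a| ^+ q * `|b| ^+ s + `|a| ^+ s * `|b| ^+ q)).
  by rewrite -!normrX -!normrM lerD ?ler_norm.
rewrite -subr_ge0.
have -> : `|a| ^+ q * `|a| ^+ s + `|b| ^+ q * `|b| ^+ s -
  (`|a| ^+ q * `|b| ^+ s + `|a| ^+ s * `|b| ^+ q) =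
  (`|a| ^+ q - `|b| ^+ q) * (`|a| ^+ s - `|b| ^+ s) by ring.
have [ab|/ltW ba] := leP `|a| `|b|.
  by rewrite -mulrNN !opprB mulr_ge0 // subr_ge0 lerXn2r ?nnegrE.
by rewrite mulr_ge0 // subr_ge0 lerXn2r ?nnegrE.
Qed.

Lemma dot_exp_spectral d (Q : 'M[R]_d) (l : 'rV[R]_d) (y : 'cV[R]_d) q :
  Q^T *m Q = 1%:M ->
  dot y ((Q *m diag_mx l *m Q^T) ^+ q *m y) =
  \sum_i l 0 i ^+ q * ((Q^T *m y) i 0) ^+ 2.
Proof.
move=> QQ; rewrite spectral_exp// spectral_quad.
by apply: eq_bigr => i _; rewrite mxE.
Qed.

(** In eigenbases of [X] and [Y] both sides are double sums over pairs of eigenvalues with the same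
    nonnegative weights, and [power_exchange] compares them term by term. *)
Lemma moment_exchange d (X Y : 'M[R]_d) (y : 'cV[R]_d) r q :
  X^T = X -> Y^T = Y -> (q <= r.*2)%N ->
  dot y (X ^+ q *m y) * dot y (Y ^+ (r.*2 - q) *m y) +
  dot y (X ^+ (r.*2 - q) *m y) * dot y (Y ^+ q *m y) <=
  dot y y * (dot y (X ^+ r.*2 *m y) + dot y (Y ^+ r.*2 *m y)).
Proof.
move=> /real_spectral[Q [l [QQ ->]]] /real_spectral[P [k [PP ->]]] qr.
rewrite mulrDr {1}(orthogonal_dot y PP) (orthogonal_dot y QQ).
rewrite [X in _ <= X + _]mulrC !dot_exp_spectral// !big_distrlr /= -!big_split /=.
apply: ler_sum => i _; rewrite -!big_split /=; apply: ler_sum => j _.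
have := power_exchange (l 0 i) (k 0 j) qr.
set A := (Q^T *m y) i 0 ^+ 2; set B := (P^T *m y) j 0 ^+ 2.
have AB : 0 <= A * B by rewrite mulr_ge0 ?sqr_ge0.
move=> /(ler_wpM2r AB); congr (_ <= _); ring.
Qed.

Lemma moment_sum d (X Y : 'M[R]_d) (y : 'cV[R]_d) r : X^T = X -> Y^T = Y ->
  2 * \sum_(q < r.*2.+1) dot y (X ^+ q *m y) * dot y (Y ^+ (r.*2 - q) *m y) <=
  r.*2.+1%:R * (dot y y * (dot y (X ^+ r.*2 *m y) + dot y (Y ^+ r.*2 *m y))).
Proof.
move=> sX sY; rewrite mulr_natl mulr2n {2}(reindex_inj rev_ord_inj)/= -big_split/=.
rewrite mulr_natl -[r.*2.+1 in leRHS]card_ord -sumr_const; apply: ler_sum => q _.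
rewrite subSS subKn -1?ltnS//; apply: moment_exchange => //; by rewrite -ltnS.
Qed.

Variables (d m : nat) (y : 'I_m -> 'cV[R]_d).
Local Notation signs := {ffun 'I_m -> bool}.

(** [true] stands for the sign -1. A sum over all [e] is [2 ^+ m] times the expectation over
    independent random signs. *)
Definition sign_sum (e : signs) : 'M[R]_d :=
  \sum_j (-1) ^+ e j *: (y j *m (y j)^T).

Definition flip (j : 'I_m) (e : signs) : signs :=
  [ffun i => (i == j) (+) e i].

Lemma flipK j : involutive (flip j).
Proof. by move=> e; apply/ffunP => i; rewrite !ffunE addbA addbb. Qed.

Lemma trmx_sign_sum e : (sign_sum e)^T = sign_sum e.
Proof.
rewrite linear_sum; apply: eq_bigr => j _.
by rewrite linearZ/= trmx_mul trmxK.
Qed.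

Lemma sign_sum_flip j e : sign_sum e - sign_sum (flip j e) =
  (2 * (-1) ^+ e j) *: (y j *m (y j)^T).
Proof.
rewrite /sign_sum (bigD1 j)//= [X in _ - X](bigD1 j)//= !ffunE eqxx signr_addb.
rewrite [X in _ - (_ + X)](eq_bigr (fun i => (-1) ^+ e i *: (y i *m (y i)^T))); last first.
  by move=> i ij; rewrite ffunE (negbTE ij).
rewrite opprD addrACA subrr addr0 -scalerBl; congr (_ *: _); rewrite expr1; ring.
Qed.

Lemma trace_rank1 (u : 'cV[R]_d) (X : 'M[R]_d) : \tr (u *m u^T *m X) = dot u (X *m u).
Proof. by rewrite -mulmxA mxtrace_mulC /mxtrace big_ord1 -mulmxA dotE. Qed.

Lemma trace_sign_sum e k :
  \tr (sign_sum e ^+ k.+1) = \sum_j (-1) ^+ e j * dot (y j) (sign_sum e ^+ k *m y j).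
Proof.
rewrite exprS {1}/sign_sum mulr_suml raddf_sum; apply: eq_bigr => j _.
by rewrite /= -mulmxE -scalemxAl mxtraceZ trace_rank1.
Qed.

(** Pairing [e] with [flip j e] turns twice the left side into a sum of the forms of
    [X ^+ r.*2.+1 - Y ^+ r.*2.+1] at [y j], up to sign, where [X - Y] is a multiple of
    [y j *m (y j)^T]. Telescoping gives products of moments of [X] and [Y], the signs square to 1,
    and [moment_sum] applies. *)
Lemma sign_moment j r :
  \sum_(e : signs) (-1) ^+ e j * dot (y j) (sign_sum e ^+ r.*2.+1 *m y j) <=
  r.*2.+1%:R *
    (dot (y j) (y j) * \sum_(e : signs) dot (y j) (sign_sum e ^+ r.*2 *m y j)).
Proof.
pose F k (e : signs) := dot (y j) (sign_sum e ^+ k *m y j).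
rewrite -/(F _) -(ler_pM2l (@ltr0Sn R 1)).
have E : 2 * (\sum_(e : signs) (-1) ^+ e j * F r.*2.+1 e) =
    \sum_(e : signs) 2 * \sum_(q < r.*2.+1) F q e * F (r.*2 - q)%N (flip j e).
  rewrite mulr_natl mulr2n {2}(reindex_inj (can_inj (flipK j)))/= -big_split/=.
  apply: eq_bigr => e _; rewrite ffunE eqxx signr_addb expr1 mulN1r mulNr -mulrBr.
  rewrite /F -dotBr -mulmxBl subrXX_noncomm mulmx_suml dot_sumr !mulr_sumr.
  apply: eq_bigr => q _; rewrite sign_sum_flip -!mulmxE -scalemxAr -!scalemxAl.
  rewrite dotZr -!mulmxA [_ *m (_ *m y j)]mx11_scalar -dotE.
  rewrite !mul_mx_scalar -scalemxAr dotZr.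
  by rewrite !mulrA -[_ * 2]mulrC -!mulrA [X in _ * X]mulrA -expr2 sqrr_sign mul1r
     [X in _ * X = _]mulrC.
rewrite E; apply: (@le_trans _ _ (\sum_(e : signs)
    r.*2.+1%:R * (dot (y j) (y j) * (F r.*2 e + F r.*2 (flip j e))))).
  by apply: ler_sum => e _; apply: moment_sum; exact: trmx_sign_sum.
rewrite -!mulr_sumr big_split /=.
rewrite -(reindex_inj (can_inj (flipK j)) (P := xpredT) (F := F r.*2)).
apply: eq_ler; rewrite /F; ring.
Qed.

(** [c] bounds the matrix variance: the form on the left is that of the sum of the squares of the
    [y j *m (y j)^T]. *)
Variable c : R.
Hypothesis yc : forall x : 'cV[R]_d,
  \sum_j dot (y j) (y j) * dot (y j) x ^+ 2 <= c * dot x x.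

(** Expanding one factor of the power and applying [sign_moment] leaves the trace of the variance
    times [X ^+ r.*2]; in an eigenbasis of [X] the hypothesis on [c] bounds the coefficient of each
    nonnegative eigenvalue power. *)
Lemma trace_sign_sum_step r :
  \sum_(e : signs) \tr (sign_sum e ^+ r.+1.*2) <=
  r.*2.+1%:R * c * \sum_(e : signs) \tr (sign_sum e ^+ r.*2).
Proof.
rewrite doubleS; under eq_bigr do rewrite trace_sign_sum.
rewrite exchange_big /=.
apply: le_trans (ler_sum _ (fun j _ => sign_moment j r)) _.
rewrite -mulr_sumr -mulrA ler_wpM2l//.
under [leLHS]eq_bigr do rewrite mulr_sumr.
rewrite exchange_big mulr_sumr /=; apply: ler_sum => e _.
have [Q [l [QQ XE]]] := real_spectral (trmx_sign_sum e).
rewrite XE; under eq_bigr do rewrite dot_exp_spectral// mulr_sumr.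
rewrite exchange_big /= spectral_exp// spectral_trace// mulr_sumr.
apply: ler_sum => i _; rewrite mxE.
have := yc (col i Q); have [_ ->] := spectral_eigenvalue l i QQ; rewrite mulr1 => h.
have e0 : 0 <= l 0 i ^+ r.*2 by rewrite -mul2n exprM exprn_ge0 ?sqr_ge0.
apply: le_trans (ler_wpM2r e0 h); rewrite mulr_suml le_eqVlt; apply/orP; left.
apply/eqP/eq_bigr => j _.
rewrite (_ : (Q^T *m y j) i 0 = dot (y j) (col i Q)); first by ring.
by rewrite mxE; apply: eq_bigr => k _; rewrite !mxE mulrC.
Qed.

(** Iterates the previous step from [\tr 1 = d]; each odd factor that occurs is at most [2 * p]. *)
Lemma trace_sign_sum_bound p r : 0 <= c -> (r <= p)%N ->
  \sum_(e : signs) \tr (sign_sum e ^+ r.*2) <=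
  (2 * p%:R * c) ^+ r * (2 ^+ m * d%:R).
Proof.
move=> c0; elim: r => [|r IH] rp.
  rewrite mul1r; under eq_bigr do rewrite expr0 mxtrace1.
  by rewrite sumr_const card_ffun card_bool card_ord -[_ *+ (2 ^ m)%N]mulr_natl natrX.
apply: le_trans (trace_sign_sum_step r) _.
rewrite exprS -[leRHS]mulrA; apply: ler_pM; first by rewrite mulr_ge0.
- apply: sumr_ge0 => e _; have [Q [l [QQ XE]]] := real_spectral (trmx_sign_sum e).
  rewrite XE spectral_exp// spectral_trace//; apply: sumr_ge0 => i _.
  by rewrite mxE -mul2n exprM exprn_ge0 ?sqr_ge0.
- by rewrite ler_wpM2r// -natrM ler_nat mul2n ltn_double.
exact: IH (ltnW rp).
Qed.

(* Instead of Jensen's inequality: [t <= 1 + t ^+ 2p], applied to [t] the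
   operator norm divided by [tau]. *)
Theorem rudelson_inequality p (tau : R) : (0 < p)%N -> (d <= 2 ^ p)%N ->
  0 <= c -> 0 <= tau -> 4 * p%:R * c <= tau ^+ 2 ->
  \sum_(e : signs) opnorm (sign_sum e) <= 2 ^+ m * (2 * tau).
Proof.
move=> p0 dp c0; have pos (t : R) : 0 < t -> 4 * p%:R * c <= t ^+ 2 ->
    \sum_(e : signs) opnorm (sign_sum e) <= 2 ^+ m * (2 * t).
  move=> t0 ct.
  have le1 (x : R) : 0 <= x -> x <= 1 + x ^+ p.*2.
    move=> x0; have [x1|/ltW x1] := leP x 1.
      by rewrite (le_trans x1)// lerDl exprn_ge0.
    rewrite (@le_trans _ _ (x ^+ p.*2))// ?lerDr//.
    by rewrite -{1}[x]expr1 ler_weXn2l// double_gt0.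
  have h e : opnorm (sign_sum e) <= t * (1 + \tr (sign_sum e ^+ p.*2) / t ^+ p.*2).
    rewrite mulrC -ler_pdivrMr//.
    apply: le_trans (le1 _ _) _; first by rewrite divr_ge0 ?opnorm_ge0 ?ltW.
    rewrite lerD2l expr_div_n ler_pM2r ?invr_gt0 ?exprn_gt0//.
    exact: opnorm_exp_le_trace (trmx_sign_sum e) p0.
  apply: le_trans (ler_sum _ (fun e _ => h e)) _.
  rewrite -mulr_sumr big_split/= sumr_const card_ffun card_bool card_ord natrX -mulr_suml.
  have -> : 2 ^+ m * (2 * t) = t * (2 ^+ m + 2 ^+ m) :> R by ring.
  rewrite ler_pM2l// lerD2l.
  rewrite ler_pdivrMr ?exprn_gt0//.
  apply: le_trans (trace_sign_sum_bound c0 (leqnn p)) _.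
  rewrite mulrCA ler_pM2l ?exprn_gt0//.
  (* Since [d <= 2 ^ p], the dimension is absorbed by doubling the base of the [p]-th power. *)
  apply: (@le_trans _ _ ((2 * p%:R * c) ^+ p * 2 ^+ p)).
    by rewrite ler_wpM2l ?exprn_ge0 ?mulr_ge0 ?mulr_ge0// -natrX ler_nat.
  rewrite -exprMn -mul2n exprM lerXn2r ?nnegrE ?sqr_ge0//; first by rewrite !mulr_ge0.
  by apply: le_trans ct; apply: eq_ler; ring.
(* [tau] may be 0, so the bound for positive numbers is applied to [tau] plus a small multiple of
   [eps]. *)
move=> t0 ct; apply/ler_addgt0Pr => eps eps0.
have p2 : 0 < 2 ^+ m * 2 :> R by rewrite mulr_gt0 ?exprn_gt0.
have <- : 2 ^+ m * (2 * (tau + eps / (2 ^+ m * 2))) = 2 ^+ m * (2 * tau) + eps.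
  by field; rewrite gt_eqF ?exprn_gt0.
apply: pos.
  by rewrite ltr_wpDl// divr_gt0.
apply: le_trans ct _; rewrite lerXn2r ?nnegrE ?addr_ge0 ?divr_ge0// ?ltW// ltrDl.
exact: divr_gt0.
Qed.

End rudelson.

(** * The bound on a finite product space *)

Section finite_product_expectation.
Context {R : realType} {K : finType} {n : nat}.
Variable p : 'I_n -> K -> R.

Definition weight (a : {ffun 'I_n -> K}) : R := \prod_j p j (a j).

Definition fexp (f : {ffun 'I_n -> K} -> R) : R := \sum_a weight a * f a.

(** The map from [(a, b)] to [(mix T a b, mix T b a)] exchanges the coordinates in [T] between two
    copies. *)
Definition mix (T : {ffun 'I_n -> bool}) (a b : {ffun 'I_n -> K}) : {ffun 'I_n -> K} :=
  [ffun j => if T j then b j else a j].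

Hypothesis p0 : forall j k, 0 <= p j k.
Hypothesis p1 : forall j, \sum_k p j k = 1.

Lemma weight_ge0 a : 0 <= weight a.
Proof. exact: prodr_ge0. Qed.

Lemma fexp_le f g : (forall a, f a <= g a) -> fexp f <= fexp g.
Proof. by move=> fg; apply: ler_sum => a _; rewrite ler_wpM2l ?weight_ge0. Qed.

Lemma fexp_ge0 f : (forall a, 0 <= f a) -> 0 <= fexp f.
Proof. by move=> f0; apply: sumr_ge0 => a _; rewrite mulr_ge0 ?weight_ge0. Qed.

Lemma fexpD f g : fexp (fun a => f a + g a) = fexp f + fexp g.
Proof. by rewrite /fexp -big_split; apply: eq_bigr => a _; rewrite mulrDr. Qed.

Lemma fexpZ c f : fexp (fun a => c * f a) = c * fexp f.
Proof. by rewrite /fexp mulr_sumr; apply: eq_bigr => a _; rewrite mulrCA. Qed.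

Lemma fexp_sum I (r : seq I) (P : pred I) (F : I -> {ffun 'I_n -> K} -> R) :
  fexp (fun a => \sum_(i <- r | P i) F i a) = \sum_(i <- r | P i) fexp (F i).
Proof.
by rewrite /fexp exchange_big; apply: eq_bigr => a _; rewrite mulr_sumr.
Qed.

Lemma fexp_marginal j (f : K -> R) : fexp (fun a => f (a j)) = \sum_k p j k * f k.
Proof.
pose g i k := p i k * (if i == j then f k else 1).
transitivity (\prod_i \sum_k g i k).
  rewrite bigA_distr_bigA; apply: eq_bigr => a _.
  rewrite /g big_split/= -/(weight a); congr (_ * _).
  by rewrite (bigD1 j)//= eqxx big1 ?mulr1// => i ij; rewrite (negbTE ij).
rewrite (bigD1 j)//= [X in _ * X]big1 ?mulr1 => [|i ij].
  by apply: eq_bigr => k _; rewrite /g eqxx.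
by rewrite /g (negbTE ij) -[RHS](p1 i); apply: eq_bigr => k _; rewrite mulr1.
Qed.

Lemma sum_weight : \sum_a weight a = 1.
Proof.
rewrite -(bigA_distr_bigA p) big1// => j _; exact: p1.
Qed.

Lemma fexp_cst c : fexp (fun=> c) = c.
Proof. by rewrite /fexp -mulr_suml sum_weight mul1r. Qed.

Lemma mixK T a b : mix T (mix T a b) (mix T b a) = a.
Proof. by apply/ffunP => j; rewrite !ffunE; case: (T j). Qed.

(** The exchange is an involution on pairs that preserves the product weight. Independent copies are
    resampled below through this identity. *)
Lemma fexp_mix T (F : {ffun 'I_n -> K} -> {ffun 'I_n -> K} -> R) :
  fexp (fun a => fexp (F a)) =
  fexp (fun a => fexp (fun b => F (mix T a b) (mix T b a))).
Proof.
pose sw (x : {ffun 'I_n -> K} * {ffun 'I_n -> K}) := (mix T x.1 x.2, mix T x.2 x.1).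
have swK : involutive sw by move=> [a b]; rewrite /sw/= !mixK.
have E (G : {ffun 'I_n -> K} -> {ffun 'I_n -> K} -> R) :
    fexp (fun a => fexp (G a)) = \sum_x weight x.1 * weight x.2 * G x.1 x.2.
  rewrite -(pair_bigA _ (fun a b => weight a * weight b * G a b)) /=.
  by apply: eq_bigr => a _; rewrite /fexp mulr_sumr; apply: eq_bigr => b _; rewrite mulrA.
rewrite !E (reindex_inj (can_inj swK)); apply: eq_bigr => -[a b] _ /=.
congr (_ * _); rewrite /weight -!big_split; apply: eq_bigr => j _ /=.
by rewrite !ffunE; case: (T j); rewrite // mulrC.
Qed.

End finite_product_expectation.

(** * Decoupling over all subsets of the columns *)

Section decoupling.
Context {R : realType} {n : nat}.

(** Of the four sets obtained from [T] by toggling [j] and [k], exactly one contains [j] but not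
    [k]. *)
Lemma sum_cut (j k : 'I_n) : j != k ->
  4 * \sum_(T : {ffun 'I_n -> bool}) (T j && ~~ T k)%:R = 2 ^+ n :> R.
Proof.
move=> jk; pose f (T : {ffun 'I_n -> bool}) := (T j && ~~ T k)%:R : R.
have kj : (k == j) = false by rewrite eq_sym (negbTE jk).
have fl i (g : {ffun 'I_n -> bool} -> R) : \sum_T g T = \sum_T g (flip i T).
  exact: reindex_inj (can_inj (flipK i)).
have -> : 4 * \sum_T f T = \sum_T f T + \sum_T f (flip j T) +
    (\sum_T f (flip k T) + \sum_T f (flip j (flip k T))).
  rewrite -(fl j f) -(fl k f) -(fl k (fun T => f (flip j T))) -(fl j f); ring.
rewrite -!big_split /= (eq_bigr (fun=> 1)) => [|T _].
  by rewrite sumr_const card_ffun card_bool card_ord -natrX.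
rewrite /f !ffunE !eqxx (negbTE jk) kj /=.
by case: (T j); case: (T k); rewrite /=; lra.
Qed.

Definition cutmx (T : {ffun 'I_n -> bool}) (M : 'M[R]_n) : 'M[R]_n :=
  \matrix_(j, k) (if T j && ~~ T k then M j k else 0).

Lemma decoupling (M : 'M[R]_n) : (forall j, M j j = 0) ->
  2 ^+ n * opnorm M <= 4 * \sum_T opnorm (cutmx T M).
Proof.
move=> M0.
have ME : 2 ^+ n *: M = 4 *: \sum_T cutmx T M.
  apply/matrixP => j k; rewrite !mxE summxE.
  have -> : \sum_T cutmx T M j k =
      M j k * \sum_(T : {ffun 'I_n -> bool}) (T j && ~~ T k)%:R.
    rewrite mulr_sumr; apply: eq_bigr => T _; rewrite mxE.
    by case: ifP => _; rewrite ?mulr1 ?mulr0.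
  have [<-|jk] := eqVneq j k; first by rewrite M0 mul0r !mulr0.
  by rewrite -(sum_cut jk) mulrC mulrCA.
have p0 : 0 < 2 ^+ n :> R by rewrite exprn_gt0.
apply: (@le_trans _ _ (opnorm (4 *: \sum_T cutmx T M))).
  rewrite mulrC -ler_pdivlMr// mulrC -ME.
  have {1}-> : M = (2 ^+ n)^-1 *: (2 ^+ n *: M) by rewrite scalerA mulVf ?scale1r ?gt_eqF.
  by apply: le_trans (opnormZ_le _ _) _; rewrite ger0_norm// invr_ge0 ltW.
apply: le_trans (opnormZ_le _ _) _; rewrite ger0_norm// ler_wpM2l//.
exact: opnorm_sum.
Qed.

End decoupling.

(** * The off-diagonal Gram matrix and the incoherence on the finite space *)

Section finite_incoherence.
Context {R : realType} {K : finType} {N n : nat}.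
Variables (p : 'I_n -> K -> R) (V : K -> 'cV[R]_N).
Hypothesis p0 : forall j k, 0 <= p j k.
Hypothesis p1 : forall j, \sum_k p j k = 1.
Implicit Types (a b c : {ffun 'I_n -> K}) (T e J : {ffun 'I_n -> bool}).

Local Notation EE := (fexp p).

Definition gram_offdiag a : 'M[R]_n :=
  \matrix_(j, k) (if j == k then 0 else dot (V (a j)) (V (a k))).

Definition max_sqnorm a : R := \big[Num.max/0]_j dot (V (a j)) (V (a j)).

Definition max_incoherence a : R :=
  \big[Num.max/0]_(j < n) \sum_(k < n | k != j) dot (V (a j)) (V (a k)) ^+ 2.

(* [T] is a set of columns, given by its characteristic function.  Those in [T]
   are taken from [b] and those outside from [a], so that the former can be
   resampled while the latter are kept. *)
Definition cutcol T a b j : 'cV[R]_n :=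
  \col_k (if T j && ~~ T k then dot (V (b j)) (V (a k)) else 0).

(** For [a = b] this is [B^T *m B], where the block [B = cutmx T (gram_offdiag a)] has the
    [cutcol T a a j] as its rows. *)
Definition cutcov T a b : 'M[R]_n :=
  \sum_j cutcol T a b j *m (cutcol T a b j)^T.

Lemma cutmx_gramE T a (u : 'cV[R]_n) j :
  (cutmx T (gram_offdiag a) *m u) j 0 = dot (cutcol T a a j) u.
Proof.
rewrite mxE; apply: eq_bigr => k _; rewrite !mxE; congr (_ * _).
by case: eqP => [<-|//]; rewrite andbN.
Qed.

Lemma dot_cutcov T a b (u : 'cV[R]_n) :
  dot u (cutcov T a b *m u) = \sum_j dot (cutcol T a b j) u ^+ 2.
Proof.
rewrite /cutcov mulmx_suml dot_sumr; apply: eq_bigr => j _.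
by rewrite -mulmxA [_ *m u]mx11_scalar -dotE mul_mx_scalar dotZr expr2 (dotC u).
Qed.

Lemma trmx_cutcov T a b : (cutcov T a b)^T = cutcov T a b.
Proof. by rewrite linear_sum; apply: eq_bigr => j _; rewrite /= trmx_mul trmxK. Qed.

Lemma sqr_opnorm_cutmx T a :
  opnorm (cutmx T (gram_offdiag a)) ^+ 2 <= opnorm (cutcov T a a).
Proof.
set B := cutmx _ _; rewrite -[leRHS]sqr_sqrtr ?opnorm_ge0//.
rewrite lerXn2r ?nnegrE ?opnorm_ge0 ?sqrtr_ge0//.
apply: opnorm_le => [|u]; first exact: sqrtr_ge0.
rewrite le_norm2 ?sqrtr_ge0// sqr_sqrtr ?opnorm_ge0//.
apply: le_trans (ler_quad_opnorm _ _).
rewrite dot_cutcov le_eqVlt; apply/orP; left; apply/eqP/eq_bigr => j _.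
by rewrite cutmx_gramE expr2.
Qed.

(** [cutcol T] reads its first family of columns only outside [T]. *)
Lemma cutcol_mixl T J a b c j : (forall k, J k -> T k) ->
  cutcol T (mix J a b) c j = cutcol T a c j.
Proof.
move=> JT; apply/colP => k; rewrite !mxE !ffunE.
case: (boolP (T k)) => Tk; first by rewrite !andbF.
by rewrite (negbTE (contra (JT k) Tk)).
Qed.

Lemma cutcol_mixr T J a b c j :
  cutcol T c (mix J a b) j = cutcol T c (if J j then b else a) j.
Proof. by apply/colP => k; rewrite !mxE !ffunE; case: (J j). Qed.

(** Exchanging between [a] and [b] the columns [j] in [T] with [e j] true keeps the columns outside
    [T] and changes the sign of exactly these terms of the difference. The triangle inequality then
    separates the two families. *)
Lemma symmetrized_cutcov T e :
  EE (fun a => EE (fun b => opnorm (cutcov T a a - cutcov T a b))) <=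
  2 * EE (fun a => opnorm (sign_sum (cutcol T a a) e)).
Proof.
pose J : {ffun 'I_n -> bool} := [ffun j => e j && T j].
have JT k : J k -> T k by rewrite ffunE => /andP[].
rewrite (fexp_mix p J).
apply: (@le_trans _ _ (EE (fun a => EE (fun b =>
   opnorm (sign_sum (cutcol T a a) e) + opnorm (sign_sum (cutcol T a b) e))))).
  apply: (fexp_le p0) => a; apply: (fexp_le p0) => b.
  have -> : cutcov T (mix J a b) (mix J a b) - cutcov T (mix J a b) (mix J b a) =
      sign_sum (cutcol T a a) e - sign_sum (cutcol T a b) e.
    rewrite /cutcov /sign_sum -!sumrB; apply: eq_bigr => j _.
    rewrite !cutcol_mixl// !cutcol_mixr ffunE.
    case: (boolP (e j)) => ej; last by rewrite /= !scale1r.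
    rewrite /= expr1 !scaleN1r opprK addrC; case: (boolP (T j)) => Tj //.
    have Z c : cutcol T a c j = 0.
      by apply/colP => k; rewrite !mxE (negbTE Tj).
    by rewrite !Z mul0mx oppr0 addr0.
  by apply: le_trans (opnormD _ _) _; rewrite opnormN.
have -> : EE (fun a => EE (fun b => opnorm (sign_sum (cutcol T a a) e) +
      opnorm (sign_sum (cutcol T a b) e))) =
    EE (fun a => opnorm (sign_sum (cutcol T a a) e)) +
    EE (fun a => EE (fun b => opnorm (sign_sum (cutcol T a b) e))).
  by rewrite -fexpD; apply: eq_bigr => a _; rewrite fexpD fexp_cst.
(* Exchanging all of [T] turns [cutcol T a b] into [cutcol T a a], after which [b] integrates
   out. *)
rewrite mulr_natl mulr2n lerD2l (fexp_mix p T).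
apply: eq_ler.
apply: eq_bigr => a _; congr (_ * _); rewrite -[RHS](fexp_cst p1).
apply: eq_bigr => b _; congr (_ * opnorm _); apply: eq_bigr => j _.
have -> : cutcol T (mix T a b) (mix T b a) j = cutcol T a a j; last by [].
rewrite cutcol_mixl// cutcol_mixr; apply/colP => k; rewrite !mxE.
by case: (T j).
Qed.

Lemma sqnorm_cutcol T a j :
  dot (cutcol T a a j) (cutcol T a a j) <= max_incoherence a.
Proof.
apply: le_trans (le_bigmax _ _ j); rewrite /dot.
rewrite [leRHS]big_mkcond /=; apply: ler_sum => k _; rewrite mxE -expr2.
case: eqVneq => [->|_] /=; first by rewrite andbN expr0n.
by case: ifP => _; rewrite ?expr0n ?sqr_ge0.
Qed.

Lemma max_incoherence_ge0 a : 0 <= max_incoherence a.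
Proof. exact: bigmax_ge_id. Qed.

(** Rudelson's inequality with [c = i * r] and [tau = r / 8 + 8 * q * i], admissible by the
    inequality of arithmetic and geometric means. The weights are chosen so that [r] returns with
    the factor 1/2 and can be absorbed later. *)
Lemma sign_sum_cutcol q T a : (0 < q)%N -> (n <= 2 ^ q)%N ->
  2 * \sum_e opnorm (sign_sum (cutcol T a a) e) <=
  2 ^+ n * (opnorm (cutcov T a a) / 2 + 32 * q%:R * max_incoherence a).
Proof.
move=> q0 nq; set r := opnorm _; set i := max_incoherence a.
have r0 : 0 <= r := opnorm_ge0 _.
have i0 : 0 <= i := max_incoherence_ge0 a.
have ir0 : 0 <= i * r by rewrite mulr_ge0.
have qi0 : 0 <= q%:R * i by rewrite mulr_ge0.
have h : \sum_e opnorm (sign_sum (cutcol T a a) e) <=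
    2 ^+ n * (2 * (r / 8 + 8 * (q%:R * i))).
  apply: (@rudelson_inequality R n n (cutcol T a a) (i * r) _ q) => //.
  - move=> x; apply: (@le_trans _ _ (i * \sum_j dot (cutcol T a a j) x ^+ 2)).
      by rewrite mulr_sumr; apply: ler_sum => j _;
        rewrite ler_wpM2r ?sqr_ge0// sqnorm_cutcol.
    by rewrite -dot_cutcov -mulrA ler_wpM2l// ler_quad_opnorm.
  - by rewrite addr_ge0 ?mulr_ge0 ?divr_ge0.
  have : 0 <= (r / 8 - 8 * (q%:R * i)) ^+ 2 := sqr_ge0 _.
  by move=> h; rewrite -subr_ge0; apply: le_trans h _; apply: eq_ler; field.
apply: le_trans (ler_wpM2l _ h) _ => //.
by apply: eq_ler; field.
Qed.

(** Isotropy of the rounded columns from above, up to the constant [beta]; [alpha] below plays the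
    same role from below. *)
Variable beta : R.
Hypothesis pV_le : forall j (x : 'cV[R]_N),
  \sum_k p j k * dot (V k) x ^+ 2 <= beta * dot x x.

(** The left side is the form of the full Gram matrix, which is its diagonal plus
    [gram_offdiag a]. *)
Lemma quad_gram a (x : 'cV[R]_n) :
  dot (\sum_k x k 0 *: V (a k)) (\sum_k x k 0 *: V (a k)) <=
  (max_sqnorm a + opnorm (gram_offdiag a)) * dot x x.
Proof.
rewrite mulrDl; have := ler_quad_opnorm (gram_offdiag a) x => /(lerD _).
move=> /(_ (dot (\sum_k x k 0 *: V (a k)) (\sum_k x k 0 *: V (a k)) -
  dot x (gram_offdiag a *m x)) (max_sqnorm a * dot x x)).
rewrite subrK; apply.
have -> : dot (\sum_k x k 0 *: V (a k)) (\sum_k x k 0 *: V (a k)) -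
    dot x (gram_offdiag a *m x) = \sum_k dot (V (a k)) (V (a k)) * (x k 0 * x k 0).
  rewrite dot_sumr [dot x _]/dot -sumrB; apply: eq_bigr => k _.
  rewrite dotZr dotC dot_sumr mxE mulr_sumr mulr_sumr -sumrB (bigD1 k)//= big1.
    rewrite !mxE eqxx dotZr; ring.
  move=> j jk; rewrite !mxE eq_sym (negbTE jk) dotZr; ring.
rewrite /dot mulr_sumr; apply: ler_sum => k _; rewrite ler_wpM2r -1?expr2 ?sqr_ge0//.
exact: (le_bigmax _ (fun j => dot (V (a j)) (V (a j)))).
Qed.

(** With [z] the combination of the columns of [a] outside [T] with coefficients from [x], each of
    the [n] indices [j] contributes at most the mean of [dot (V (b j)) z ^+ 2]. This is at most
    [beta |z|^2], and [quad_gram] bounds [|z|^2]. *)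
Lemma opnorm_mean_cutcov T a : 0 <= beta ->
  opnorm (\sum_b weight p b *: cutcov T a b) <=
  n%:R * (beta * (max_sqnorm a + opnorm (gram_offdiag a))).
Proof.
move=> beta0; set g := max_sqnorm a + _.
have g0 : 0 <= g by rewrite addr_ge0 ?opnorm_ge0 ?bigmax_ge_id.
apply: opnorm_le_quad; rewrite ?mulr_ge0//.
  by rewrite linear_sum; apply: eq_bigr => b _; rewrite /= linearZ/= trmx_cutcov.
move=> x; rewrite mulmx_suml dot_sumr.
have -> : \sum_b dot x (weight p b *: cutcov T a b *m x) =
   \sum_j EE (fun b => dot (cutcol T a b j) x ^+ 2).
  rewrite -fexp_sum; apply: eq_bigr => b _.
  by rewrite -scalemxAl dotZr dot_cutcov.
rewrite ger0_norm; last first.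
  by apply: sumr_ge0 => j _; apply: (fexp_ge0 p0) => b; exact: sqr_ge0.
rewrite -[n%:R * _ * _]mulrA -[n in n%:R]card_ord mulr_natl -sumr_const.
apply: ler_sum => j _.
pose xS : 'cV[R]_n := \col_k (if T k then 0 else x k 0).
pose z := \sum_k xS k 0 *: V (a k).
have xSx : dot xS xS <= dot x x.
  apply: ler_sum => k _; rewrite mxE; case: (T k) => //.
  by rewrite mul0r -expr2 sqr_ge0.
apply: (@le_trans _ _ (EE (fun b => dot (V (b j)) z ^+ 2))).
  apply: (fexp_le p0) => b; have [Tj|Tj] := boolP (T j); last first.
    have -> : cutcol T a b j = 0 by apply/colP => k; rewrite !mxE (negbTE Tj).
    by rewrite dotC dot0r expr0n /= sqr_ge0.
  apply: eq_ler; congr (_ ^+ 2).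
  rewrite dot_sumr; apply: eq_bigr => k _; rewrite dotZr !mxE Tj /=.
  by case: (T k); rewrite ?mul0r ?mulr0// mulrC.
rewrite (fexp_marginal p1 j (fun k => dot (V k) z ^+ 2)).
apply: le_trans (pV_le _ _) _; rewrite -mulrA ler_wpM2l//.
apply: le_trans (quad_gram _ _) _; by rewrite ler_wpM2l.
Qed.

(** Split [cutcov T a a] into its mean [M a] over the resampled columns and a fluctuation. The
    fluctuation, averaged over all sign patterns, costs half of the left side [w] plus the
    incoherence term, and that half is moved to the left. *)
Lemma fexp_opnorm_cutcov T q : 0 <= beta -> (0 < q)%N -> (n <= 2 ^ q)%N ->
  EE (fun a => opnorm (cutcov T a a)) <=
  2 * n%:R * beta * (EE max_sqnorm + EE (fun a => opnorm (gram_offdiag a))) +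
  64 * q%:R * EE max_incoherence.
Proof.
move=> beta0 q0 nq; set w := EE _.
pose M a := \sum_b weight p b *: cutcov T a b.
have wM : w <= EE (fun a => opnorm (M a)) +
    EE (fun a => EE (fun b => opnorm (cutcov T a a - cutcov T a b))).
  rewrite -fexpD; apply: (fexp_le p0) => a.
  rewrite -lerBlDl; apply: (@le_trans _ _ (opnorm (cutcov T a a - M a))).
    by rewrite lerBlDr -{1}[cutcov T a a](subrK (M a)) opnormD.
  have -> : cutcov T a a - M a = \sum_b weight p b *: (cutcov T a a - cutcov T a b).
    rewrite /M; under [RHS]eq_bigr do rewrite scalerBr.
    by rewrite sumrB -scaler_suml (sum_weight p1) scale1r.
  apply: le_trans (opnorm_sum _ _ _) _; apply: ler_sum => b _.
  by apply: le_trans (opnormZ_le _ _) _; rewrite ger0_norm// (weight_ge0 p0).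
have n2 : 0 < 2 ^+ n :> R by rewrite exprn_gt0.
have sy : EE (fun a => EE (fun b => opnorm (cutcov T a a - cutcov T a b))) <=
    w / 2 + 32 * q%:R * EE max_incoherence.
  rewrite -(ler_pM2l n2) mulrC.
  apply: (@le_trans _ _ (\sum_e 2 * EE (fun a => opnorm (sign_sum (cutcol T a a) e)))).
    have -> : 2 ^+ n = #|{ffun 'I_n -> bool}|%:R :> R.
      by rewrite card_ffun card_bool card_ord natrX.
    rewrite mulr_natr -sumr_const; apply: ler_sum => e _; exact: symmetrized_cutcov.
  rewrite -mulr_sumr -fexp_sum -fexpZ.
  apply: le_trans (fexp_le p0 (fun a => sign_sum_cutcol T a q0 nq)) _.
  rewrite fexpZ fexpD fexpZ ler_pM2l// lerD2r.
  by rewrite mulrC -fexpZ; apply: (fexp_le p0) => a; rewrite mulrC.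
have MM : EE (fun a => opnorm (M a)) <=
    n%:R * beta * (EE max_sqnorm + EE (fun a => opnorm (gram_offdiag a))).
  rewrite -fexpD -fexpZ; apply: (fexp_le p0) => a.
  by rewrite -mulrA; exact: opnorm_mean_cutcov.
rewrite -!mulrA in MM sy wM *; lra.
Qed.

(** [D * x <= D ^+ 2 / 8 + 2 * x ^+ 2] replaces Jensen's inequality for the norm [x] of a block.
    With decoupling this gives [D ^+ 2 <= D ^+ 2 / 2 + 8 * Z]. *)
Lemma sqr_fexp_opnorm_le q : 0 <= beta -> (0 < q)%N -> (n <= 2 ^ q)%N ->
  EE (fun a => opnorm (gram_offdiag a)) ^+ 2 <=
  16 * (2 * n%:R * beta * (EE max_sqnorm + EE (fun a => opnorm (gram_offdiag a))) +
  64 * q%:R * EE max_incoherence).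
Proof.
move=> beta0 q0 nq; set D := EE (fun a => opnorm (gram_offdiag a)); set Z := _ + _.
have n2 : 0 < 2 ^+ n :> R by rewrite exprn_gt0.
have D0 : 0 <= D by apply: (fexp_ge0 p0) => a; exact: opnorm_ge0.
have h T : D * EE (fun a => opnorm (cutmx T (gram_offdiag a))) <= D ^+ 2 / 8 + 2 * Z.
  apply: (@le_trans _ _ (D ^+ 2 / 8 + 2 * EE (fun a => opnorm (cutcov T a a)))); last first.
    by rewrite lerD2l ler_pM2l//; exact: fexp_opnorm_cutcov.
  rewrite -(fexp_cst p1 (D ^+ 2 / 8)) -!fexpZ -fexpD; apply: (fexp_le p0) => a.
  apply: (@le_trans _ _ (D ^+ 2 / 8 +
      2 * opnorm (cutmx T (gram_offdiag a)) ^+ 2)); last first.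
    by rewrite lerD2l ler_pM2l// sqr_opnorm_cutmx.
  move: (opnorm _) => x; have := sqr_ge0 (D - 4 * x); lra.
have dec : 2 ^+ n * D <= 4 * \sum_T EE (fun a => opnorm (cutmx T (gram_offdiag a))).
  rewrite -fexp_sum -!fexpZ; apply: (fexp_le p0) => a.
  by apply: decoupling => j; rewrite mxE eqxx.
have : 2 ^+ n * D ^+ 2 <= 2 ^+ n * (4 * (D ^+ 2 / 8 + 2 * Z)).
  rewrite {1}expr2 mulrA; apply: le_trans (ler_wpM2r D0 dec) _.
  rewrite -mulrA [_ * D]mulrC mulr_sumr [leRHS]mulrCA ler_pM2l//.
  have -> : 2 ^+ n = #|{ffun 'I_n -> bool}|%:R :> R.
    by rewrite card_ffun card_bool card_ord natrX.
  by rewrite [leRHS]mulr_natl -sumr_const; apply: ler_sum => T _.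
rewrite ler_pM2l//; lra.
Qed.

Variable alpha : R.
Hypothesis pV_ge : forall j (x : 'cV[R]_N),
  alpha * dot x x <= \sum_k p j k * dot (V k) x ^+ 2.

(** The maximum dominates the sum for one fixed [j0]. By independence the lower isotropy bound
    applies first to column [k], then to column [j0] along the basis vectors, which gives
    [alpha ^+ 2 * N] for each of the [n.-1] terms. *)
Lemma fexp_max_incoherence_ge : 0 <= alpha -> (0 < n)%N ->
  n.-1%:R * (alpha * (alpha * N%:R)) <= EE max_incoherence.
Proof.
move=> alpha0 n0; pose j0 : 'I_n := Ordinal n0.
apply: (@le_trans _ _ (EE (fun a =>
    \sum_(k < n | k != j0) dot (V (a j0)) (V (a k)) ^+ 2))); last first.
  apply: (fexp_le p0) => a.
  exact: (le_bigmax _ (fun j => \sum_(k < n | k != j) dot (V (a j)) (V (a k)) ^+ 2)).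
rewrite fexp_sum.
have -> : n.-1 = #|[pred k : 'I_n | k != j0]| by rewrite cardC1 card_ord.
rewrite mulr_natl -sumr_const; apply: ler_sum => k kj.
have -> : EE (fun a => dot (V (a j0)) (V (a k)) ^+ 2) =
   EE (fun a => EE (fun b => dot (V (a j0)) (V (b k)) ^+ 2)).
  transitivity (EE (fun a => EE (fun b => dot (V (a j0)) (V (a k)) ^+ 2))).
    by apply: eq_bigr => a _; rewrite fexp_cst.
  (* Exchanging the single coordinate [k] makes that column an independent copy. *)
  rewrite (fexp_mix p [ffun j => j == k]).
  apply: eq_bigr => a _; congr (_ * _); apply: eq_bigr => b _.
  by rewrite !ffunE eqxx eq_sym (negbTE kj).
apply: (@le_trans _ _ (EE (fun a => alpha * dot (V (a j0)) (V (a j0))))); last first.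
  apply: (fexp_le p0) => a.
  rewrite (fexp_marginal p1 k (fun x => dot (V (a j0)) (V x) ^+ 2)).
  apply: le_trans (pV_ge k _) _; apply: eq_ler.
  by apply: eq_bigr => x _; rewrite dotC.
rewrite fexpZ ler_wpM2l// /dot fexp_sum -[N in N%:R]card_ord mulr_natr -sumr_const.
apply: ler_sum => i _; rewrite (fexp_marginal p1 j0 (fun x => V x i 0 * V x i 0)).
have de (x : 'cV[R]_N) : dot x (delta_mx i 0) = x i 0.
  rewrite /dot (bigD1 i)//= big1 ?mxE ?eqxx ?mulr1 ?addr0// => l li.
  by rewrite mxE (negbTE li) mulr0.
have := pV_ge j0 (delta_mx i 0); rewrite de mxE !eqxx mulr1 => h; apply: le_trans h _.
apply: eq_ler.
by apply: eq_bigr => x _; rewrite de expr2.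
Qed.

End finite_incoherence.

(** * Solving the quadratic inequality with explicit constants *)

Section finite_bound.
Context {R : realType}.

Lemma dyadic_exponent_le_ln n : (2 <= n)%N ->
  exists q, [/\ (0 < q)%N, (n <= 2 ^ q)%N & q%:R <= 4 * ln n%:R :> R].
Proof.
move=> n2; exists (up_log 2 n); split.
- by rewrite lt0n up_log_eq0 -ltnNge.
- exact: up_logP.
have h : (2 ^ (up_log 2 n).-1 < n)%N.
  exact: up_log_gtn.
have q0 : (0 < up_log 2 n)%N by rewrite lt0n up_log_eq0 -ltnNge.
(* From [ln (1 + x) <= x] at [x = - 1 / 2]. Then [q - 1 <= 2 ln n] and [1 <= 2 ln n] add up to the
   factor 4. *)
have l2 : 1 / 2 <= ln 2 :> R.
  have : ln (1 + (- (1 / 2))) <= - (1 / 2) :> R by apply: le_ln1Dx; lra.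
  rewrite (_ : 1 + - (1 / 2) = 2^-1) ?lnV ?posrE//; last by field.
  lra.
have : ln (2 ^+ (up_log 2 n).-1) <= ln n%:R :> R.
  by rewrite ler_ln ?posrE ?exprn_gt0 ?ltr0n ?(ltnW n2)// -natrX ler_nat ltnW.
rewrite lnXn// => h1.
have h2 : ln 2 <= ln n%:R :> R by rewrite ler_ln ?posrE ?ltr0n ?(ltnW n2)// ler_nat.
have -> : (up_log 2 n)%:R = (up_log 2 n).-1%:R + 1 :> R by rewrite natr1 prednK.
have x0 : 0 <= (up_log 2 n).-1%:R :> R := ler0n _ _.
have := ler_wpM2l x0 l2; rewrite -[ln 2 *+ _]mulr_natl in h1; lra.
Qed.

(** Here [beta = 3] and [alpha = 1 / 4]. The lower bound on the incoherence [I] gives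
    [n N <= 2 (n - 1) N <= 32 I], so the terms in [n N] and [n ^ 2] are dominated by [q I]. *)
Theorem finite_incoherence_bound (K : finType) N n
    (p : 'I_n -> K -> R) (V : K -> 'cV[R]_N) :
  (2 <= n)%N -> (n <= N)%N ->
  (forall j k, 0 <= p j k) -> (forall j, \sum_k p j k = 1) ->
  (forall j (x : 'cV[R]_N), \sum_k p j k * dot (V k) x ^+ 2 <= 3 * dot x x) ->
  (forall j (x : 'cV[R]_N), 4^-1 * dot x x <= \sum_k p j k * dot (V k) x ^+ 2) ->
  fexp p (max_sqnorm V) <= 3 * N%:R ->
  N%:R <= 16 * fexp p (max_incoherence V) /\
  fexp p (fun a => opnorm (gram_offdiag V a)) ^+ 2 <=
    2 ^+ 21 * (ln n%:R * fexp p (max_incoherence V)).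
Proof.
move=> n2 nN p0 p1 pV_le pV_ge max_le.
have [q [q0 nq qln]] := dyadic_exponent_le_ln n2.
have := sqr_fexp_opnorm_le p0 p1 pV_le (ler0n _ 3) q0 nq.
have := fexp_max_incoherence_ge p0 p1 pV_ge (ltac:(by rewrite invr_ge0)) (ltnW n2).
have : 0 <= fexp p (fun a => opnorm (gram_offdiag V a)).
  by apply: fexp_ge0 => // a; exact: opnorm_ge0.
move: (fexp p _) max_le => M max_le; move: (fexp p _) => D.
move: (fexp p _) => I D0 I1 DI.
have nN' : n%:R <= N%:R :> R by rewrite ler_nat.
have n0 : (0 < n)%N := ltnW n2.
have n1 : (1 <= n.-1)%N by rewrite -ltnS prednK.
have nn1 : n%:R <= 2 * n.-1%:R :> R.
  by rewrite -natrM ler_nat mul2n -addnn -{1}(prednK n0) -add1n leq_add2r.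
have m1 : 1 <= n.-1%:R :> R by rewrite ler1n.
have qq : 1 <= q%:R :> R by rewrite ler1n.
have N0 : 0 <= N%:R :> R := ler0n _ _.
have x0 : 0 <= n%:R :> R := ler0n _ _.
have yz : N%:R <= n.-1%:R * N%:R :> R by rewrite ler_peMl.
have NI : N%:R <= 16 * I by lra.
have I0 : 0 <= I by lra.
have xz : n%:R * N%:R <= 2 * (n.-1%:R * N%:R) :> R by rewrite mulrA ler_wpM2r.
have xM : n%:R * M <= n%:R * (3 * N%:R) by rewrite ler_wpM2l.
have xx : n%:R * n%:R <= n%:R * N%:R :> R by rewrite ler_wpM2l.
(* Absorbs the term [96 n D] of the quadratic inequality into [D ^+ 2 / 2]. *)
have xD : 0 <= (D - 96 * n%:R) ^+ 2 := sqr_ge0 _.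
have qI : I <= q%:R * I by rewrite ler_peMl.
have lI : q%:R * I <= 4 * ln n%:R * I by rewrite ler_wpM2r.
have -> : 2 ^+ 21 = 64 * 64 * 64 * 8 :> R by ring.
by split; last lra.
Qed.

End finite_bound.

(** * Discretization and transfer *)

Section borel_cells.
Context {R : realType} {N : nat}.

Lemma open_halfspace i (c : R) : open [set u : 'cV[R]_N | u i 0 < c].
Proof.
rewrite (_ : [set _ | _] = (fun u : 'cV[R]_N => u i 0) @^-1` [set x | x < c])//.
apply: open_comp; last exact: open_lt.
by move=> u _; exact: coord_continuous.
Qed.

Lemma measurable_coord d (T : measurableType d) (X : T -> 'cV[R]_N) i :
  random_vector X -> measurable_fun setT (fun w => X w i 0).
Proof.
move=> mX; apply: (measurability _ (RGenInftyO.measurableE R)) => //.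
move=> _ [_ [c ->] <-]; rewrite setTI.
rewrite (_ : _ @^-1` _ = X @^-1` [set u | u i 0 < c]); last first.
  by apply/seteqP; split => w /=; rewrite in_itv.
by apply: mX; apply: sub_sigma_algebra; exact: open_halfspace.
Qed.

Context {m : nat} (t : 'I_m -> R).

(** A grid cell is recorded by all comparisons of a coordinate with a threshold: the index type is
    finite and every cell is a finite intersection of half-spaces and complements of half-spaces. *)
Definition cell (u : 'cV[R]_N) : {ffun 'I_N * 'I_m -> bool} :=
  [ffun x => t x.2 <= u x.1 0].

Lemma borel_cell k : borel (cell @^-1` [set k]).
Proof.
have -> : cell @^-1` [set k] = \bigcap_(x in [set: 'I_N * 'I_m])
    [set u | (t x.2 <= u x.1 0) = k x].
  apply/seteqP; split => [u <- x _|u ku] /=; first by rewrite ffunE.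
  by apply/ffunP => x; rewrite ffunE; exact: ku.
apply: (@fin_bigcap_measurable _ (g_sigma_algebraType (@open 'cV[R]_N))) => //.
move=> x _ /=; have h : open.-sigma.-measurable [set u : 'cV[R]_N | u x.1 0 < t x.2].
  by apply: sub_sigma_algebra; exact: open_halfspace.
case: (k x); [have := measurableC h|have := h]; congr measurable.
  by apply/seteqP; split => u /=; rewrite leNgt => /negP.
by apply/seteqP; split => u /=; rewrite leNgt; [move=> ->|move/negbFE].
Qed.

End borel_cells.

(** * Integrals of dominated and of finitely valued functions *)

Section lower_integral.
Import HBNNSimple.
Local Open Scope ereal_scope.
Context d {T : measurableType d} {R : realType} (mu : {measure set T -> \bar R}).

(* [f] need not be measurable: the integral of a nonnegative function is a
   supremum of integrals of simple functions below it. *)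
Lemma ae_le_lower_integral (f g : T -> \bar R) :
  (forall x, 0 <= f x) -> (forall x, 0 <= g x) -> measurable_fun setT g ->
  {ae mu, forall x, f x <= g x} -> \int[mu]_x f x <= \int[mu]_x g x.
Proof.
move=> f0 g0 mg fg; rewrite ge0_integralTE//.
apply: ge_ereal_sup => _ [h /= hf <-]; rewrite -integralT_nnsfun.
apply: ae_ge0_le_integral => //; last first.
  by apply: filterS fg => x fgx _; apply: le_trans fgx.
- by apply/measurable_EFinP; exact: measurable_funPT.
- by move=> x _; rewrite lee_fin.
Qed.

End lower_integral.

Section finite_valued.
Context d {T : measurableType d} {R : realType} (P : probability T R).

Lemma integral_finite_valued (I : finType) (g : T -> I) (F : I -> R) :
  (forall i, measurable (g @^-1` [set i])) -> (forall i, 0 <= F i) ->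
  measurable_fun setT (fun w => (F (g w))%:E) /\
  (\int[P]_w (F (g w))%:E = (\sum_i fine (P (g @^-1` [set i])) * F i)%:E)%E.
Proof.
move=> mg F0.
have E w : ((F (g w))%:E = \sum_i (F i * \1_(g @^-1` [set i]) w)%:E)%E.
  rewrite (bigD1 (g w))//= big1 ?adde0.
    by rewrite indicE mem_set// mulr1.
  by move=> i ig; rewrite indicE memNset ?mulr0//= => gi; rewrite gi eqxx in ig.
have mf i : measurable_fun setT (fun w => (F i * \1_(g @^-1` [set i]) w)%:E).
  by apply/measurable_EFinP; apply: measurable_funM => //; exact: measurable_indic.
under [X in measurable_fun _ X]eq_fun do rewrite E.
split; first exact: emeasurable_sum.
under eq_integral do rewrite E.
rewrite ge0_integral_sum//=; last first.
  by move=> i w _; rewrite lee_fin mulr_ge0.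
rewrite -sumEFin; apply: eq_bigr => i _.
under eq_integral do rewrite EFinM.
rewrite ge0_integralZl//; last first.
- by rewrite lee_fin.
- by apply/measurable_EFinP; exact: measurable_indic.
by rewrite integral_indic// setIT EFinM fineK ?fin_num_measure// muleC//.
Qed.

End finite_valued.

(** * Rounding points of the sphere of radius [sqrt N] *)

Section quantization.
Context {R : realType} {N : nat}.
Implicit Types u v x : 'cV[R]_N.

Lemma norm2_le_coord u c : (forall i, `|u i 0| <= c) -> norm2 u <= N%:R * c.
Proof.
move=> uc; case: N u uc => [|n] u uc.
  by rewrite mul0r /norm2 /dot big_ord0 sqrtr0.
have c0 : 0 <= c := le_trans (normr_ge0 _) (uc 0).
rewrite -ler_sqr ?nnegrE ?mulr_ge0 ?norm2_ge0// sqr_norm2 exprMn.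
apply: (@le_trans _ _ (n.+1%:R * c ^+ 2)).
  rewrite -[n.+1 in leRHS]card_ord mulr_natl -sumr_const; apply: ler_sum => i _.
  by rewrite -expr2 -(real_normK (num_real _)) lerXn2r ?nnegrE.
by rewrite ler_wpM2r ?sqr_ge0// -natrX ler_nat expnS expn1 leq_pmulr.
Qed.

(** One point of the sphere is chosen in each cell; the default 0 occurs only for cells that miss
    the sphere. *)
Definition representative m (t : 'I_m -> R) (k : {ffun 'I_N * 'I_m -> bool}) : 'cV[R]_N :=
  xget 0 [set u | cell t u = k /\ norm2 u = Num.sqrt N%:R].

Lemma grid_close (delta : R) m (x y : R) : 0 < delta ->
  2 * N%:R <= m%:R * delta -> `|x| <= N%:R -> `|y| <= N%:R ->
  (forall l : 'I_m, (- N%:R + l.+1%:R * delta <= x) = (- N%:R + l.+1%:R * delta <= y)) ->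
  `|x - y| <= delta.
Proof.
move=> d0 md; wlog xy : x y / x <= y.
  move=> h hx hy xy; have [le|/ltW le] := leP x y; first exact: h.
  by rewrite distrC; apply: h => // l; rewrite xy.
move=> hx hy h; rewrite ler0_norm ?subr_le0// opprB leNgt; apply/negP => lt.
(* The threshold with index [l] is the first grid point above [x], at distance at most [delta]; if
   [y] exceeded [x + delta], it would separate the two. *)
pose l := Num.truncn ((x + N%:R) / delta).
have xN : 0 <= (x + N%:R) / delta.
  apply: divr_ge0; last exact: ltW.
  by move: hx; rewrite ler_norml => /andP[]; lra.
have /andP[l1 l2] := truncn_itv xN; rewrite -/l in l1 l2.
have l1' : l%:R * delta <= x + N%:R by rewrite -ler_pdivlMr.
have l2' : x + N%:R < l.+1%:R * delta by rewrite -ltr_pdivrMr.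
have y1 : y <= N%:R by move: hy; rewrite ler_norml => /andP[].
have lm : (l < m)%N.
  rewrite -(ltr_nat R) -(ltr_pM2r d0); apply: lt_le_trans md; lra.
have := h (Ordinal lm) => /=.
have -> : (- N%:R + l.+1%:R * delta <= x) = false by apply/negbTE; rewrite -ltNge; lra.
move/esym/negbT; rewrite -ltNge -natr1 mulrDl mul1r; lra.
Qed.

Lemma quantization : (0 < N)%N ->
  exists (m : nat) (t : 'I_m -> R), forall u, norm2 u = Num.sqrt N%:R ->
    norm2 (representative t (cell t u)) = Num.sqrt N%:R /\
    norm2 (representative t (cell t u) - u) <= (128 * N%:R ^+ 3)^-1.
Proof.
move=> N0; have N0' : 0 < N%:R :> R by rewrite ltr0n.
have N1 : 1 <= N%:R :> R by rewrite ler1n.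
(* A coordinate error [delta] gives a norm error of at most [N * delta], the required precision;
   [256 * N ^ 5] steps of this size cover an interval of length [2 * N]. *)
pose delta : R := (128 * N%:R ^+ 4)^-1.
have d0 : 0 < delta by rewrite invr_gt0 mulr_gt0// exprn_gt0.
exists (256 * N ^ 5)%N, (fun l => - N%:R + l.+1%:R * delta) => u uN.
rewrite /representative; case: xgetP => [v -> [/= cvu vN]|/(_ u)]; last by case.
split=> //; apply: (@le_trans _ _ (N%:R * delta)); last first.
  apply: eq_ler; rewrite /delta; field; exact: lt0r_neq0.
have sN : Num.sqrt N%:R <= N%:R :> R.
  by rewrite -{2}[N%:R]ger0_norm// -sqrtr_sqr ler_wsqrtr// expr2 ler_peMl.
have coordN (w : 'cV[R]_N) (i : 'I_N) : norm2 w = Num.sqrt N%:R -> `|w i 0| <= N%:R.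
  by move=> wN; apply: le_trans (norm2_coord _ _) _; rewrite wN.
apply: norm2_le_coord => i; rewrite 2!mxE.
apply: (@grid_close delta (256 * N ^ 5)%N); rewrite ?coordN//.
  rewrite natrM natrX le_eqVlt; apply/orP; left; apply/eqP; rewrite /delta; field.
  exact: lt0r_neq0.
by move=> l; have /ffunP/(_ (i, l)) := cvu; rewrite !ffunE.
Qed.

End quantization.

(** * Effect of the rounding on Gram entries, incoherence and isotropy *)

Section perturbation.
Context {R : realType} {N n : nat} {K : finType}.
Variables (V : K -> 'cV[R]_N) (A : 'M[R]_(N, n)) (a : {ffun 'I_n -> K}).
Hypothesis N0 : (0 < N)%N.
Hypothesis nN : (n <= N)%N.
Hypothesis AN : forall j, norm2 (col j A) = Num.sqrt N%:R.
Hypothesis VN : forall j, norm2 (V (a j)) = Num.sqrt N%:R.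
Hypothesis VA : forall j, norm2 (V (a j) - col j A) <= (128 * N%:R ^+ 3)^-1.

Let N1 : 1 <= N%:R :> R. Proof. by rewrite ler1n. Qed.
Let sN : Num.sqrt N%:R <= N%:R :> R.
Proof. by rewrite -{2}[N%:R]ger0_norm// -sqrtr_sqr ler_wsqrtr// expr2 ler_peMl. Qed.

Lemma dot_perturbation j k :
  `|dot (V (a j)) (V (a k)) - dot (col j A) (col k A)| <= (64 * N%:R ^+ 2)^-1.
Proof.
have -> : dot (V (a j)) (V (a k)) - dot (col j A) (col k A) =
   dot (V (a j) - col j A) (V (a k)) + dot (col j A) (V (a k) - col k A).
  rewrite [dot (_ - _) _]dotC !dotBr.
  rewrite (dotC (V (a k)) (V (a j))) (dotC (V (a k)) (col j A)); ring.
apply: le_trans (ler_normD _ _) _.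
have -> : (64 * N%:R ^+ 2)^-1 =
    (128 * N%:R ^+ 3)^-1 * N%:R + N%:R * (128 * N%:R ^+ 3)^-1 :> R.
  by field; rewrite gt_eqF// ltr0n.
by rewrite lerD// (le_trans (ler_dot_norm2 _ _))// ler_pM ?norm2_ge0// ?VN ?AN.
Qed.

Lemma sqr_dot_perturbation j k :
  `|dot (V (a j)) (V (a k)) ^+ 2 - dot (col j A) (col k A) ^+ 2| <= (32 * N%:R)^-1.
Proof.
have bA : `|dot (col j A) (col k A)| <= N%:R.
  by apply: le_trans (ler_dot_norm2 _ _) _; rewrite !AN -expr2 sqr_sqrtr.
have bV : `|dot (V (a j)) (V (a k))| <= N%:R.
  by apply: le_trans (ler_dot_norm2 _ _) _; rewrite !VN -expr2 sqr_sqrtr.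
rewrite subr_sqr normrM.
have -> : (32 * N%:R)^-1 = (64 * N%:R ^+ 2)^-1 * (N%:R + N%:R) :> R.
  by field; rewrite gt_eqF// ltr0n.
apply: ler_pM => //; first exact: dot_perturbation.
by apply: le_trans (ler_normD _ _) _; rewrite lerD.
Qed.

(** The diagonal of [A^T *m A] is exactly [N], so the error [E] has zero diagonal. Its at most
    [N ^ 2] entries are bounded by [1 / (64 N ^ 2)], hence its norm is at most 1. *)
Lemma opnorm_perturbation :
  opnorm (N%:R^-1 *: (A^T *m A) - 1%:M) <= N%:R^-1 * (opnorm (gram_offdiag V a) + 1).
Proof.
have n0' : N%:R != 0 :> R by rewrite gt_eqF// ltr0n.
pose E : 'M[R]_n := A^T *m A - N%:R%:M - gram_offdiag V a.
have -> : N%:R^-1 *: (A^T *m A) - 1%:M = N%:R^-1 *: (gram_offdiag V a + E).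
  rewrite /E [gram_offdiag V a + _]addrC subrK scalerBr; congr (_ - _).
  by rewrite scale_scalar_mx mulVf.
apply: le_trans (opnormZ_le _ _) _.
rewrite ger0_norm ?invr_ge0// ler_wpM2l ?invr_ge0//.
apply: le_trans (opnormD _ _) _; rewrite lerD2l.
apply: le_trans (@opnorm_le_entries _ _ _ E (64 * N%:R ^+ 2)^-1 _) _.
  move=> j k; have AE : (A^T *m A) j k = dot (col j A) (col k A).
    by rewrite mxE; apply: eq_bigr => i _; rewrite !mxE.
  have -> : E j k = dot (col j A) (col k A) - N%:R *+ (j == k) - gram_offdiag V a j k.
    by rewrite -AE /E !mxE.
  rewrite mxE; case: eqP => [<-|_].
    rewrite -sqr_norm2 AN sqr_sqrtr// mulr1n !subrr normr0.
    by rewrite invr_ge0 mulr_ge0 ?exprn_ge0.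
  by rewrite mulr0n subr0 distrC dot_perturbation.
rewrite ler_pdivrMr ?mul1r; last by rewrite mulr_gt0// exprn_gt0// ltr0n.
have : (n * n)%:R <= N%:R ^+ 2 :> R by rewrite -natrX ler_nat expnS expn1 leq_mul.
have := sqr_ge0 (N%:R : R); lra.
Qed.

Lemma incoherence_perturbation :
  max_incoherence V a <=
  \big[Num.max/0]_(j < n) (\sum_(k < n | k != j) dot (col j A) (col k A) ^+ 2) + 32^-1.
Proof.
apply: bigmax_le.
  by rewrite addr_ge0 ?invr_ge0// bigmax_ge_id.
move=> j _; rewrite -lerBlDr.
apply: le_trans (le_bigmax _ (fun j =>
   \sum_(k < n | k != j) dot (col j A) (col k A) ^+ 2) j).
rewrite lerBlDr -lerBlDl -sumrB.
apply: (@le_trans _ _ (\sum_(k < n) (32 * N%:R)^-1)).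
  rewrite big_mkcond /=; apply: ler_sum => k _; case: ifP => _.
    exact: le_trans (ler_norm _) (sqr_dot_perturbation j k).
  by rewrite invr_ge0 mulr_ge0.
rewrite sumr_const card_ord -[_ *+ n]mulr_natl invfM mulrCA ler_piMr ?invr_ge0//.
by rewrite ler_pdivrMr ?ltr0n// mul1r ler_nat.
Qed.

(** The rounding error has norm at most 1/2, and [s ^+ 2 <= 2 t ^+ 2 + 2 (s - t) ^+ 2]. *)
Lemma dot_sqr_perturbation j x :
  dot (V (a j)) x ^+ 2 <= 2 * dot (col j A) x ^+ 2 + 2^-1 * dot x x /\
  dot (col j A) x ^+ 2 <= 2 * dot (V (a j)) x ^+ 2 + 2^-1 * dot x x.
Proof.
have h : (dot (V (a j)) x - dot (col j A) x) ^+ 2 <= 4^-1 * dot x x.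
  rewrite dotC (dotC (col j A)) -dotBr dotC.
  apply: le_trans (CauchySchwarz_dot _ _) _; rewrite ler_wpM2r ?dot_ge0//.
  rewrite -sqr_norm2 (_ : 4^-1 = 2^-1 ^+ 2); last by field.
  rewrite lerXn2r ?nnegrE ?norm2_ge0// (le_trans (VA j))//.
  rewrite lef_pV2 ?posrE ?mulr_gt0 ?exprn_gt0 ?ltr0n//.
  have : 1 <= N%:R ^+ 3 :> R by rewrite exprn_ege1.
  lra.
move: (dot (V _) _) (dot (col _ _) _) (dot x x) h => s t r h.
split; have := sqr_ge0 (2 * t - s); have := sqr_ge0 (2 * s - t); lra.
Qed.

End perturbation.

Lemma measurable_bigmaxr d (T : measurableType d) (R : realType) I (s : seq I)
    (F : I -> T -> R) : (forall i, measurable_fun setT (F i)) ->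
  measurable_fun setT (fun w => \big[Num.max/0]_(i <- s) F i w).
Proof.
move=> mF; elim: s => [|i s IH].
  under eq_fun do rewrite big_nil.
  exact: measurable_cst.
under eq_fun do rewrite big_cons.
exact: measurable_maxr.
Qed.

(** * Transfer from the finite product space to the random matrix *)

Section transfer.
Context {R : realType} d (T : measurableType d) (P : probability T R).
Variables (N n : nat) (A : T -> 'M[R]_(N, n)).
Hypothesis N0 : (0 < N)%N.
Hypothesis mA : forall j : 'I_n, random_vector (fun w => col j (A w)).
Hypothesis iA : independent P (fun (j : 'I_n) w => col j (A w)).
Hypothesis isoA : forall j : 'I_n, isotropic P (fun w => col j (A w)).
Hypothesis nA : forall j : 'I_n, {ae P, forall w, norm2 (col j (A w)) = Num.sqrt N%:R}.

Definition column_incoherence (w : T) : R :=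
  \big[Num.max/0]_(j < n) \sum_(k < n | k != j) dot (col j (A w)) (col k (A w)) ^+ 2.

Lemma ae_columns : {ae P, forall w, forall j, norm2 (col j (A w)) = Num.sqrt N%:R}.
Proof. exact: filter_forall. Qed.

Lemma measurable_entry i j : measurable_fun setT (fun w => A w i j).
Proof.
have := @measurable_coord R N d T _ i (mA j).
by congr measurable_fun; apply/funext => w; rewrite mxE.
Qed.

Lemma measurable_column_dot j k :
  measurable_fun setT (fun w => dot (col j (A w)) (col k (A w))).
Proof.
apply: measurable_sum => i; under eq_fun do rewrite !mxE.
by apply: measurable_funM; exact: measurable_entry.
Qed.

Lemma measurable_column_dotr j x : measurable_fun setT (fun w => dot (col j (A w)) x).
Proof.
apply: measurable_sum => i; under eq_fun do rewrite !mxE.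
by apply: measurable_funM => //; exact: measurable_entry.
Qed.

Lemma measurable_column_incoherence : measurable_fun setT column_incoherence.
Proof.
apply: measurable_bigmaxr => j; under eq_fun do rewrite big_mkcond.
apply: measurable_sum => k.
by case: (k != j) => //; apply: measurable_funX; exact: measurable_column_dot.
Qed.

Lemma column_incoherence_ge0 w : 0 <= column_incoherence w.
Proof. exact: bigmax_ge_id. Qed.

Lemma ae_le_integral_cst (f : T -> R) c : (forall w, 0 <= f w) -> 0 <= c ->
  {ae P, forall w, f w <= c} -> (\int[P]_w (f w)%:E <= c%:E)%E.
Proof.
move=> f0 c0 fc.
have <- : (\int[P]_w (cst c%:E) w = c%:E)%E.
  by rewrite integral_cst//= probability_setT mule1.
apply: ae_le_lower_integral => [w|w||]; rewrite ?lee_fin//.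
Qed.

(** Integrability comes from the almost sure bound [sqrt N] on the entries, the value from
    isotropy. *)
Lemma integral_column_entries j i k :
  P.-integrable setT (fun w => (A w i j * A w k j)%:E) /\
  (\int[P]_w (A w i j * A w k j)%:E = ((i == k)%:R)%:E)%E.
Proof.
split.
  apply/integrableP; split.
    by apply/measurable_EFinP; apply: measurable_funM; exact: measurable_entry.
  apply: (@le_lt_trans _ _ (N%:R)%:E); last by rewrite ltry.
  under eq_integral do rewrite abse_EFin.
  apply: ae_le_integral_cst => //.
  apply: filterS ae_columns => w /(_ j) nj; rewrite normrM.
  have b l : `|A w l j| <= Num.sqrt N%:R.
    by rewrite -nj; have := norm2_coord (col j (A w)) l; rewrite mxE.
  by rewrite -[leRHS]sqr_sqrtr// expr2 ler_pM.
have := isoA j i k; rewrite unlock [in RHS]mxE => <-.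
apply: eq_integral => w _; congr (_%:E).
by rewrite mxE big_ord1 !mxE.
Qed.

Lemma integral_sqr_column_dot j (x : 'cV[R]_N) :
  (\int[P]_w (dot (col j (A w)) x ^+ 2)%:E = (dot x x)%:E)%E.
Proof.
have E w : ((dot (col j (A w)) x ^+ 2)%:E = \sum_(z : 'I_N * 'I_N)
    (x z.1 0 * x z.2 0)%:E * (A w z.1 j * A w z.2 j)%:E)%E.
  rewrite expr2 /dot big_distrlr /= pair_bigA /= -sumEFin; apply: eq_bigr => z _.
  by rewrite -EFinM !mxE; congr (_%:E); ring.
under eq_integral do rewrite E.
rewrite integral_sum//=; last first.
  by move=> z; apply: integrableZl => //; have [] := integral_column_entries j z.1 z.2.
under eq_bigr => z _.
  rewrite integralZl//; last by have [] := integral_column_entries j z.1 z.2.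
  rewrite (integral_column_entries j z.1 z.2).2 -EFinM; over.
rewrite sumEFin; congr (_%:E).
rewrite -(pair_bigA _ (fun i k => x i 0 * x k 0 * (i == k)%:R)) /=.
apply: eq_bigr => i _; rewrite (bigD1 i)//= eqxx mulr1 big1 ?addr0// => k ki.
by rewrite eq_sym (negbTE ki) mulr0.
Qed.

Variables (m : nat) (t : 'I_m -> R).
Local Notation K := {ffun 'I_N * 'I_m -> bool}.

Definition cell_prob (j : 'I_n) (k : K) : R :=
  fine (P ((fun w => cell t (col j (A w))) @^-1` [set k])).

Definition cells (w : T) : {ffun 'I_n -> K} := [ffun j => cell t (col j (A w))].

Lemma measurable_cell_col j k :
  measurable ((fun w => cell t (col j (A w))) @^-1` [set k]).
Proof. exact: (mA j (borel_cell t k)). Qed.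

Lemma cellsE a : cells @^-1` [set a] =
  \bigcap_(j in [set` [set: 'I_n]%SET])
    (fun w => col j (A w)) @^-1` (cell t @^-1` [set a j]).
Proof.
apply/seteqP; split => [w <- j _|w h] /=; first by rewrite ffunE.
by apply/ffunP => j; rewrite ffunE; apply: h; rewrite /= inE.
Qed.

Lemma measurable_cells a : measurable (cells @^-1` [set a]).
Proof.
rewrite cellsE; apply: fin_bigcap_measurable => // j _; exact: measurable_cell_col.
Qed.

(** Independence of the columns enters here: the event is an intersection of Borel conditions, one
    for each column. *)
Lemma cells_law a : fine (P (cells @^-1` [set a])) = weight cell_prob a.
Proof.
rewrite cellsE (iA _ (B := fun j => cell t @^-1` [set a j])); last first.
  by move=> j; exact: borel_cell.
rewrite /weight; under [in LHS]eq_bigl do rewrite inE.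
rewrite (eq_bigr (fun j => (cell_prob j (a j))%:E)).
  by rewrite prodEFin.
by move=> j _; rewrite /cell_prob fineK// fin_num_measure//; exact: measurable_cell_col.
Qed.

Lemma integral_cells (F : {ffun 'I_n -> K} -> R) : (forall a, 0 <= F a) ->
  measurable_fun setT (fun w => (F (cells w))%:E) /\
  (\int[P]_w (F (cells w))%:E = (fexp cell_prob F)%:E)%E.
Proof.
move=> F0; have [mF ->] := integral_finite_valued P measurable_cells F0.
by split=> //; congr (_%:E); apply: eq_bigr => a _; rewrite cells_law.
Qed.

Lemma integral_cell j (F : K -> R) : (forall k, 0 <= F k) ->
  measurable_fun setT (fun w => (F (cell t (col j (A w))))%:E) /\
  (\int[P]_w (F (cell t (col j (A w))))%:E = (\sum_k cell_prob j k * F k)%:E)%E.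
Proof. by move=> F0; exact: (integral_finite_valued P (measurable_cell_col j) F0). Qed.

Lemma cell_prob_ge0 j k : 0 <= cell_prob j k.
Proof. exact: fine_ge0. Qed.

Lemma sum_cell_prob j : \sum_k cell_prob j k = 1.
Proof.
have [_] := @integral_cell j (fun=> 1) (fun=> ler01).
rewrite integral_cst//= probability_setT mule1 => -[E]; rewrite [RHS]E.
by apply: eq_bigr => k _; rewrite mulr1.
Qed.



Hypothesis nN : (n <= N)%N.
Hypothesis tP : forall u : 'cV[R]_N, norm2 u = Num.sqrt N%:R ->
  norm2 (representative t (cell t u)) = Num.sqrt N%:R /\
  norm2 (representative t (cell t u) - u) <= (128 * N%:R ^+ 3)^-1.

Local Notation V := (representative t).

Lemma ae_cells : {ae P, forall w, forall j,
  [/\ norm2 (col j (A w)) = Num.sqrt N%:R, norm2 (V (cells w j)) = Num.sqrt N%:R &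
      norm2 (V (cells w j) - col j (A w)) <= (128 * N%:R ^+ 3)^-1]}.
Proof.
apply: filterS ae_columns => w nw j; have [h1 h2] := tP (nw j).
by rewrite ffunE.
Qed.

Lemma fexp_max_sqnorm_le : fexp cell_prob (max_sqnorm V) <= N%:R.
Proof.
have F0 (a : {ffun 'I_n -> K}) : 0 <= max_sqnorm V a by exact: bigmax_ge_id.
rewrite -lee_fin -(integral_cells F0).2.
apply: ae_le_integral_cst => //; apply: filterS ae_cells => w h.
apply: bigmax_le => // j _; have [_ hj _] := h j.
by rewrite -sqr_norm2 hj sqr_sqrtr.
Qed.

Lemma fexp_max_incoherence_le Em : (\int[P]_w (column_incoherence w)%:E = Em%:E)%E ->
  fexp cell_prob (max_incoherence V) <= Em + 32^-1.
Proof.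
move=> EmE.
have F0 (a : {ffun 'I_n -> K}) : 0 <= max_incoherence V a by exact: bigmax_ge_id.
have m1 : measurable_fun setT (fun w => (column_incoherence w)%:E).
  by apply/measurable_EFinP; exact: measurable_column_incoherence.
rewrite -lee_fin -(integral_cells F0).2 EFinD -EmE.
have -> : ((\int[P]_w (column_incoherence w)%:E) + (32^-1)%:E =
    \int[P]_w ((column_incoherence w)%:E + (32^-1)%:E))%E.
  rewrite ge0_integralD//=; first by rewrite integral_cst//= probability_setT mule1.
  by move=> w _; rewrite lee_fin column_incoherence_ge0.
apply: ae_le_lower_integral => [w|w||]; rewrite ?lee_fin//.
- by rewrite addr_ge0// column_incoherence_ge0.
- by apply: emeasurable_funD.
apply: filterS ae_cells => w h; rewrite lee_fin.
by apply: incoherence_perturbation => // j; have [] := h j.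
Qed.

(** Integrating the two pointwise comparisons against the exact isotropy of the column gives
    [S <= (2 + 1/2) |x|^2] and [|x|^2 <= 2 S + |x|^2 / 2]. *)
Lemma cell_moment_bounds j (x : 'cV[R]_N) :
  \sum_k cell_prob j k * dot (V k) x ^+ 2 <= 3 * dot x x /\
  4^-1 * dot x x <= \sum_k cell_prob j k * dot (V k) x ^+ 2.
Proof.
have F0 (k : K) : 0 <= dot (V k) x ^+ 2 := sqr_ge0 _.
have [mF intF] := integral_cell j F0.
set S := \sum_k _ in intF *; have xx : 0 <= dot x x := dot_ge0 x.
pose c := 2^-1 * dot x x; have c0 : 0 <= c by rewrite mulr_ge0.
have aff (f : T -> R) (I : R) : (forall w, 0 <= f w) ->
    measurable_fun setT (fun w => (f w)%:E) ->
    (\int[P]_w (f w)%:E = I%:E)%E ->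
    measurable_fun setT (fun w => (2 * f w + c)%:E) /\
    (\int[P]_w (2 * f w + c)%:E = (2 * I + c)%:E)%E.
  move=> f0 mf If; have m2 : measurable_fun setT (fun w => (2%:E * (f w)%:E)%E).
    exact: measurable_funeM.
  under eq_fun do rewrite EFinD EFinM.
  split; first exact: emeasurable_funD.
  under eq_integral do rewrite EFinD EFinM.
  rewrite ge0_integralD//=.
  - rewrite ge0_integralZl// ?lee_fin//; last by move=> w _; rewrite lee_fin.
    by rewrite integral_cst//= probability_setT mule1 If EFinD EFinM.
  - by move=> w _; rewrite mule_ge0// lee_fin.
  have mD : measurable_fun setT (fun w => (dot (col j (A w)) x ^+ 2)%:E).
  by apply/measurable_EFinP; apply: measurable_funX; exact: measurable_column_dotr.
have [m1 I1] := aff _ _ (fun w => sqr_ge0 _) mD (integral_sqr_column_dot j x).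
have [m2 I2] := aff _ _ (fun w => F0 _) mF intF.
have h1 : S <= 2 * dot x x + c.
  rewrite -lee_fin -intF -I1; apply: ae_le_lower_integral => [w|w||]; rewrite ?lee_fin//.
    by rewrite addr_ge0// mulr_ge0 ?sqr_ge0.
  apply: filterS ae_cells => w h; rewrite lee_fin.
  have := @dot_sqr_perturbation R N n K V (A w) (cells w) N0
    (fun j => let: And3 _ _ h := h j in h) j x.
  by rewrite ffunE => -[].
have h2 : dot x x <= 2 * S + c.
  rewrite -lee_fin -(integral_sqr_column_dot j x) -I2.
  apply: ae_le_lower_integral => [w|w||]; rewrite ?lee_fin ?sqr_ge0//.
    by rewrite addr_ge0// mulr_ge0.
  apply: filterS ae_cells => w h; rewrite lee_fin.
  have := @dot_sqr_perturbation R N n K V (A w) (cells w) N0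
    (fun j => let: And3 _ _ h := h j in h) j x.
  by rewrite ffunE => -[].
by rewrite /c in h1 h2; split; lra.
Qed.

Lemma integral_column_incoherence_fin :
  exists2 Em, 0 <= Em & (\int[P]_w (column_incoherence w)%:E = Em%:E)%E.
Proof.
have i0 : (0 <= \int[P]_w (column_incoherence w)%:E)%E.
  by apply: integral_ge0 => w _; rewrite lee_fin column_incoherence_ge0.
have : (\int[P]_w (column_incoherence w)%:E <= (\sum_(k < n) N%:R ^+ 2)%:E)%E.
  apply: ae_le_integral_cst => [w||]; first exact: column_incoherence_ge0.
    by apply: sumr_ge0 => k _; exact: sqr_ge0.
  apply: filterS ae_columns => w h; apply: bigmax_le => [|j _].
    by apply: sumr_ge0 => k _; exact: sqr_ge0.
  rewrite big_mkcond /=; apply: ler_sum => k _; case: ifP => _; last exact: sqr_ge0.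
  rewrite -(real_normK (num_real _)) lerXn2r ?nnegrE//.
  by apply: le_trans (ler_dot_norm2 _ _) _; rewrite !h -expr2 sqr_sqrtr.
case: (\int[P]_w _)%E i0 => [r|//|//]; rewrite lee_fin => r0 _.
by exists r.
Qed.

(** [Y], a function of the cells, is a measurable majorant of the deviation with a computable
    integral; both estimates of the theorem follow from it. *)
Lemma deviation_bound_ge2 : (2 <= n)%N -> exists (Y : T -> R) D Em,
  [/\ measurable_fun setT (fun w => (Y w)%:E), forall w, 0 <= Y w,
   {ae P, forall w, opnorm (N%:R^-1 *: ((A w)^T *m A w) - 1%:M) <= Y w},
   (\int[P]_w (Y w)%:E = D%:E)%E /\ (\int[P]_w (column_incoherence w)%:E = Em%:E)%E &
   D <= 2 ^+ 12 * Num.sqrt (N%:R^-1 * Em * ln n%:R * N%:R^-1)].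
Proof.
move=> n2; have [Em Em0 EmE] := integral_column_incoherence_fin.
have IEm := fexp_max_incoherence_le EmE.
have N3 : fexp cell_prob (max_sqnorm V) <= 3 * N%:R.
  by have := fexp_max_sqnorm_le; have := ler0n R N; lra.
have [NI DI] := finite_incoherence_bound n2 nN cell_prob_ge0 sum_cell_prob
  (fun j x => (cell_moment_bounds j x).1) (fun j x => (cell_moment_bounds j x).2)
  N3.
have F0 (a : {ffun 'I_n -> K}) : 0 <= opnorm (gram_offdiag V a) := opnorm_ge0 _.
have [mF intF] := integral_cells F0.
have D0 := fexp_ge0 cell_prob_ge0 F0.
move: (fexp _ _) IEm NI DI => I IEm NI; move: (fexp _ _) intF D0 => D intF D0 DI.
have Ni0 : 0 <= N%:R^-1 :> R by rewrite invr_ge0.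
exists (fun w => N%:R^-1 * (opnorm (gram_offdiag V (cells w)) + 1)),
  (N%:R^-1 * (D + 1)), Em.
have mF1 : measurable_fun setT (fun w => ((opnorm (gram_offdiag V (cells w)))%:E + 1%:E)%E).
  exact: emeasurable_funD.
split.
- by under eq_fun do rewrite EFinM EFinD; exact: measurable_funeM.
- by move=> w; rewrite mulr_ge0// addr_ge0.
- apply: filterS ae_cells => w h.
  by apply: opnorm_perturbation => // j; have [] := h j.
- split=> //; under eq_integral do rewrite EFinM EFinD.
  rewrite ge0_integralZl//; last by move=> w _; rewrite adde_ge0 ?lee_fin.
  rewrite ge0_integralD//=; last by move=> w _; rewrite lee_fin.
  by rewrite intF integral_cst//= probability_setT mule1 -EFinD -EFinM.
have ln2 : 1 <= 4 * ln n%:R :> R.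
  have [q [q0 _ ql]] := @dyadic_exponent_le_ln R n n2; apply: le_trans ql; by rewrite ler1n.
have N2 : 2 <= N%:R :> R by rewrite ler_nat (leq_trans n2).
have -> : N%:R^-1 * Em * ln n%:R * N%:R^-1 = (N%:R^-1) ^+ 2 * (ln n%:R * Em) by ring.
rewrite sqrtrM ?sqr_ge0// sqrtr_sqr ger0_norm// mulrCA ler_wpM2l//.
have lE0 : 0 <= ln n%:R * Em by rewrite mulr_ge0//; lra.
rewrite -ler_sqr ?nnegrE ?addr_ge0 ?mulr_ge0 ?sqrtr_ge0 ?exprn_ge0//.
rewrite exprMn sqr_sqrtr// -exprM.
(* [N >= 2] and [N <= 16 I] give [I >= 1 / 8], so the rounding error 1/32 in [I <= Em + 1/32] is at
   most [Em]. *)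
have I2 : I <= 2 * Em by lra.
have I4 : ln n%:R * I <= ln n%:R * (2 * Em) by rewrite ler_wpM2l//; lra.
have E1 : 1 <= 16 * Em by lra.
have L1 : 16 * Em <= 4 * ln n%:R * (16 * Em) by rewrite ler_peMl//; lra.
(* Gives [(D + 1) ^+ 2 <= 2 D ^+ 2 + 2]; the constant 2 is dominated by [ln n * Em] through [E1] and
   [L1]. *)
have := sqr_ge0 (D - 1).
have -> : 2 ^+ (12 * 2) = 16 * 16 * 16 * 16 * 16 * 16 :> R by ring.
have E21 : 2 ^+ 21 = 16 * 16 * 16 * 16 * 16 * 2 :> R by ring.
rewrite E21 in DI; lra.
Qed.

End transfer.

(** * The case of one column, and the bound for singular values *)

Section main.
Context {R : realType} d (T : measurableType d) (P : probability T R).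
Variables (N n : nat) (A : T -> 'M[R]_(N, n)).
Hypothesis n0 : (0 < n)%N.
Hypothesis nN : (n <= N)%N.
Hypothesis mA : forall j : 'I_n, random_vector (fun w => col j (A w)).
Hypothesis iA : independent P (fun (j : 'I_n) w => col j (A w)).
Hypothesis isoA : forall j : 'I_n, isotropic P (fun w => col j (A w)).
Hypothesis nA : forall j : 'I_n, {ae P, forall w, norm2 (col j (A w)) = Num.sqrt N%:R}.

(** For [n = 1] the right side vanishes because [ln 1 = 0]; so does the deviation almost surely, its
    only entry being [|A_1|^2 / N - 1], and [Y = 0] serves. *)
Lemma deviation_bound : exists (Y : T -> R) D Em,
  [/\ measurable_fun setT (fun w => (Y w)%:E), forall w, 0 <= Y w,
   {ae P, forall w, opnorm (N%:R^-1 *: ((A w)^T *m A w) - 1%:M) <= Y w},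
   (\int[P]_w (Y w)%:E = D%:E)%E /\ (\int[P]_w (column_incoherence A w)%:E = Em%:E)%E &
   D <= 2 ^+ 12 * Num.sqrt (N%:R^-1 * Em * ln n%:R * N%:R^-1)].
Proof.
have N0 : (0 < N)%N := leq_trans n0 nN.
have [n2|n1] := leqP 2 n.
  have [m [t tP]] := @quantization R N N0.
  exact: (deviation_bound_ge2 N0 mA iA isoA nA nN tP n2).
have nE : n = 1%N by apply/eqP; rewrite eqn_leq n0 -ltnS n1.
have [Em Em0 EmE] := integral_column_incoherence_fin nA.
exists (fun=> 0), 0, Em; split=> //.
- apply: filterS (ae_columns nA) => w h.
  rewrite -[leRHS](mulr0 (n * n)%:R); apply: opnorm_le_entries => i j.
  have v0 (k : 'I_n) : val k = 0%N.
    by have := leq_trans (ltn_ord k) (eq_leq nE); rewrite ltnS leqn0 => /eqP.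
  have -> : i = j by apply: val_inj; rewrite !v0.
  have AE : ((A w)^T *m A w) j j = N%:R.
    have <- : dot (col j (A w)) (col j (A w)) = N%:R by rewrite -sqr_norm2 h sqr_sqrtr.
    by rewrite mxE; apply: eq_bigr => k _; rewrite !mxE.
  have -> : (N%:R^-1 *: ((A w)^T *m A w) - 1%:M) j j = N%:R^-1 * ((A w)^T *m A w) j j - 1.
    by rewrite !mxE eqxx.
  by rewrite AE mulVf ?subrr ?normr0// gt_eqF ?ltr0n.
- by rewrite integral0.
Qed.

End main.

Theorem theorem5p62 (R : realType) :
  exists C0 C : R, [/\ 0 < C0, 0 < C &
    forall (d : measure_display) (T : measurableType d) (P : probability T R)
      (N n : nat) (A : T -> 'M[R]_(N, n)),
      (0 < n)%N -> (n <= N)%N ->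
      (forall j : 'I_n, random_vector (fun w => col j (A w))) ->
      independent P (fun (j : 'I_n) w => col j (A w)) ->
      (forall j : 'I_n, isotropic P (fun w => col j (A w))) ->
      (forall j : 'I_n,
        {ae P, forall w, norm2 (col j (A w)) = Num.sqrt N%:R}) ->
      let m := incoherence P A in
      ('E_P[fun w => opnorm (N%:R^-1 *: ((A w)^T *m A w) - 1%:M)%R]
         <= C0%:E * sqrte (m * (ln n%:R)%:E * (N%:R^-1)%:E))%E
      /\
      ('E_P[fun w => (\big[Num.max/0]_(j < n)
                        `|singular_value (A w) j - Num.sqrt N%:R|)%R]
         <= C%:E * sqrte (m * (ln n%:R)%:E))%E].
Proof.
exists (2 ^+ 12), (2 ^+ 12); split; rewrite ?exprn_gt0//.
move=> d T P N n A n0 nN mA iA isoA nA m.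
have [Y [D [Em [mY Y0 XY [DE EmE] DEm]]]] := deviation_bound n0 nN mA iA isoA nA.
have mE : m = (N%:R^-1 * Em)%:E by rewrite /m /incoherence unlock EFinM -EmE.
have N0 : (0 < N)%N := leq_trans n0 nN.
split; rewrite unlock mE -!EFinM /=.
  apply: (@le_trans _ _ D%:E); last by rewrite lee_fin.
  rewrite -DE; apply: ae_le_lower_integral => //.
  by move=> w; rewrite lee_fin opnorm_ge0.
have s0 : 0 <= Num.sqrt N%:R :> R := sqrtr_ge0 _.
(* Each singular value deviates from [sqrt N] by at most [sqrt N] times the norm deviation, and this
   factor cancels the [1 / N] under the square root. *)
apply: (@le_trans _ _ (Num.sqrt N%:R * D)%:E).
  have -> : ((Num.sqrt N%:R * D)%:E = \int[P]_w ((Num.sqrt N%:R)%:E * (Y w)%:E))%E.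
    by rewrite ge0_integralZl// ?DE ?EFinM// => w _; rewrite lee_fin.
  apply: ae_le_lower_integral => [w|w||].
  - by rewrite lee_fin bigmax_ge_id.
  - by rewrite mule_ge0// lee_fin.
  - exact: measurable_funeM.
  apply: filterS XY => w XYw; rewrite -EFinM lee_fin; apply: bigmax_le.
    by rewrite mulr_ge0.
  move=> j _; apply: le_trans (singular_value_deviation (A w) j N0) _.
  by rewrite ler_wpM2l.
rewrite lee_fin; apply: le_trans (ler_wpM2l s0 DEm) _.
rewrite mulrCA ler_wpM2l ?exprn_ge0// -sqrtrM ?ler0n//.
by rewrite mulrC divfK// gt_eqF// ltr0n.
Qed.
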